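(* For every rational number $\nu$, $$\sum_{i,j,k\geq 0} \frac{q^{4i^2+3j^2+3k^2-4ij-4ik+2jk+2\nu j-2\nu k}}{(q^8;q^8)_i(q^8;q^8)_j(q^8;q^8)_k} =\frac{J_8^3\overline{J}_{4(\nu+2),16}}{J_4^2J_{16}^2}+2q^{2\nu+3}\frac{J_{16}^2\overline{J}_{-4\nu,16}}{J_8^3}.$$ Moreover, \begin{align*} \sum_{i,j,k\geq 0} \frac{q^{4i^2+3j^2+3k^2-4ij-4ik+2jk+4k}}{(q^8;q^8)_i(q^8;q^8)_j(q^8;q^8)_k} &=\frac{J_6^5}{J_3^2J_4J_{12}^2}, \\ \sum_{i,j,k\geq 0} \frac{q^{4i^2+3j^2+3k^2-4ij-4ik+2jk+4i-2j+2k}}{(q^8;q^8)_i(q^8;q^8)_j(q^8;q^8)_k} &=\frac{J_{16}^7}{J_8^5J_{32}^2}+q\frac{J_8^3J_{32}^2}{J_4^2J_{16}^3}, \\ \sum_{i,j,k\geq 0} \frac{q^{4i^2+3j^2+3k^2-4ij-4ik+2jk-4i+2j+2k}}{(q^8;q^8)_i(q^8;q^8)_j(q^8;q^8)_k} &=2\frac{J_2^2J_3J_{12}}{J_1J_4^2J_{6}}, \\ \sum_{i,j,k\geq 0} \frac{q^{4i^2+3j^2+3k^2-4ij-4ik+2jk-4i}}{(q^8;q^8)_i(q^8;q^8)_j(q^8;q^8)_k} &=2q^{-1}\frac{J_2^5}{J_1^2J_4^3}. \end{align*}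
   Context: Here $q=e^{2\pi \mathrm{i}\tau}$ with $\mathrm{Im}\,\tau>0$, and $q^r:=e^{2\pi \mathrm{i} r\tau}$ for rational $r$. Notation: $(a;q)_n=\prod_{k=0}^{n-1}(1-aq^k)$, $(a;q)_\infty=\prod_{k\ge0}(1-aq^k)$, $(a_1,\dots,a_r;q)_\infty=\prod_s(a_s;q)_\infty$; $J_m:=(q^m;q^m)_\infty$ and $\overline{J}_{a,m}:=(-q^a,-q^{m-a},q^m;q^m)_\infty$ for any rational $a$. *)

(* Defs.v *)
From mathcomp Require Import all_boot all_order all_algebra.
From mathcomp Require Import all_classical all_reals all_analysis.
From mathcomp Require Export complex.
From mathcomp Require summability.

Set Implicit Arguments.
Unset Strict Implicit.
Unset Printing Implicit Defensive.

Import Order.TTheory GRing.Theory Num.Theory.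
Import numFieldNormedType.Exports.

Local Open Scope classical_set_scope.
Local Open Scope ring_scope.

(* The notions involving limits are stated over an arbitrary numFieldType, which
   carries the topology of its norm; they are used below at K := R[i]. *)

Definition qpoch (K : numFieldType) (a q : K) (n : nat) : K :=
  \prod_(k < n) (1 - a * q ^+ k).

Definition qpoch_inf (K : numFieldType) (a q : K) : K :=
  lim (qpoch a q n @[n --> \oo]).

Definition qpochs_inf (K : numFieldType) (s : seq K) (q : K) : K :=
  \prod_(a <- s) qpoch_inf a q.

(* Unconditional summation: convergence of the net of sums over the finite
   subsets of the index set, ordered by inclusion. *)
Definition has_sum (I : choiceType) (K : numFieldType) (f : I -> K) (s : K) :=
  summability.partial_sum f @ summability.totally --> s.

Definition cexp (R : realType) (z : R[i]) : R[i] :=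
  (expR (complex.Re z))%:C%C *
  (cos (complex.Im z) +i* sin (complex.Im z))%C.

(* q^r for q = exp(2 pi i tau): it depends on tau, and not only on q, when r is
   not an integer. *)
Definition qpow (R : realType) (tau : R[i]) (r : rat) : R[i] :=
  cexp (2 * (pi : R)%:C%C * 'i%C * ratr r * tau).

Definition J (R : realType) (tau : R[i]) (m : rat) : R[i] :=
  qpoch_inf (qpow tau m) (qpow tau m).

Definition Jbar (R : realType) (tau : R[i]) (a m : rat) : R[i] :=
  qpochs_inf [:: - qpow tau a; - qpow tau (m - a); qpow tau m] (qpow tau m).

Definition quad (i j k : rat) : rat :=
  4 * i ^+ 2 + 3 * j ^+ 2 + 3 * k ^+ 2 - 4 * i * j - 4 * i * k + 2 * j * k.

Definition term (R : realType) (tau : R[i]) (a b c : rat)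
    (x : nat * nat * nat) : R[i] :=
  let: (i, j, k) := x in
  let Q8 := qpow tau 8 in
  qpow tau (quad i%:R j%:R k%:R + a * i%:R + b * j%:R + c * k%:R)
  / (qpoch Q8 Q8 i * qpoch Q8 Q8 j * qpoch Q8 Q8 k).

(* Main.v *)
(* Write n = j + k, d = j - k, Q = q^8, and a for the coefficient of i in the linear
   part of the exponent. The quadratic form of the triple sum is
   4 i^2 - 4 i n + 2 n^2 + d^2, so Euler's identity sums over i and leaves
   q^(2 n^2 + d^2) (-q^(4 + a - 4 n); Q)_oo / ((Q; Q)_j (Q; Q)_k) times linear
   exponents. Along a diagonal d = const a limiting case of the q-Gauss sum applies
   as soon as the linear exponents in j and k are opposite; the sum over d that
   remains is, according to the parity of d, a theta series, evaluated by the Jacobi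
   triple product. When the linear exponents are not opposite, the sum over
   j + k = n is done first, by the q-binomial theorem; it is then rewritten by the
   finite identity for 1 / (q^4; q^4)_n, in the spirit of a change of Bailey pair,
   as a sum over j + k = n with weight q^(2 d^2 + 2 d), which brings us back to the
   diagonal summation and produces theta series in q^3. *)
Require Import Defs.
From mathcomp Require Import all_boot all_order all_algebra.
From mathcomp Require Import all_classical all_reals all_analysis.
From mathcomp Require Import finmap ring lra zify.

Set Implicit Arguments.
Unset Strict Implicit.
Unset Printing Implicit Defensive.

Import Order.TTheory GRing.Theory Num.Theory.
Import numFieldNormedType.Exports.
Local Open Scope ring_scope.

(** Why parity decides: by the triple product, [kappa d] times [E] is the sum of q^(m^2) over m
    congruent to d modulo 2, so [kappa] takes only two values and [kappa d * kappa (d + 1)] is a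
    constant. A diagonal therefore contributes a Gaussian in d times one of two constants. For a =
    4, recentring the two products at opposite arguments costs a denominator 1 + q^(4 d). It
    disappears only when the summand is added to its image under d -> - d, for which the exponents
    -2 j + 2 k are exactly suited; such sums are evaluated twice over and then halved. In the
    non-opposite cases the linear part is 2 (j + k) plus an opposite part. Comparing antidiagonals
    moves a from 0 to 4, or from -4 to 0, and puts one [kappa] into the new weight; the diagonal
    summation supplies the neighbouring [kappa], and the exponents 2 d^2 and d^2 add up to the 3 d^2
    of the theta series in q^3. A rational nu is harmless: the analysis is done for an arbitrary
    nonzero x in place of q^(2 nu), and powers depending on tau enter only at the end. *)

Local Notation N := Normc.normc.

(* Stated for a numFieldType K, so that K := R[i] gets the topology of its norm. *)
Definition seq_cvg (K : numFieldType) (u : nat -> K) (l : K) : Prop :=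
  (u n @[n --> \oo] --> l)%classic.

(** * Norm on the complex numbers *)

Section Norm.
Context {R : realType}.
Local Notation C := (R[i])%C.
Implicit Types x y z : C.

Lemma normE z : `|z| = ((N z)%:C)%C.
Proof. by rewrite normc_def; case: z. Qed.

Lemma N_ge0 z : 0 <= N z.
Proof. by rewrite -ler0c -normE normr_ge0. Qed.

Lemma N0 : N (0 : C) = 0. Proof. exact: Normc.normc0. Qed.
Lemma N1 : N (1 : C) = 1. Proof. exact: Normc.normc1. Qed.

Lemma N_eq0 z : (N z == 0) = (z == 0).
Proof. by rewrite -(inj_eq (@complexI R)) -normE normr_eq0. Qed.

Lemma N_gt0 z : (0 < N z) = (z != 0).
Proof. by rewrite lt_neqAle N_ge0 andbT eq_sym N_eq0. Qed.

Lemma NM x y : N (x * y) = N x * N y.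
Proof. exact: Normc.normcM. Qed.

Lemma NN x : N (- x) = N x.
Proof. exact: normcN. Qed.

Lemma NV x : N x^-1 = (N x)^-1.
Proof. exact: Normc.normcV. Qed.

Lemma ND x y : N (x + y) <= N x + N y.
Proof. exact: le_normcD. Qed.

Lemma NB x y : N (x - y) <= N x + N y.
Proof. by rewrite -[N y]NN ND. Qed.

Lemma NBC x y : N (x - y) = N (y - x).
Proof. by rewrite -NN opprB. Qed.

Lemma Ntri z x y : N (x - y) <= N (x - z) + N (z - y).
Proof. by apply: le_trans (ND _ _); rewrite addrA subrK. Qed.

Lemma NX x n : N (x ^+ n) = N x ^+ n.
Proof. by elim: n => [|n IH]; rewrite ?expr0 ?N1 // !exprS NM IH. Qed.

Lemma NXz x (n : int) : N (x ^ n) = N x ^ n.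
Proof. by case: n => n; rewrite /exprz ?NV NX. Qed.

Lemma Nsum (I : Type) (r : seq I) (f : I -> C) :
  N (\sum_(i <- r) f i) <= \sum_(i <- r) N (f i).
Proof.
elim: r => [|i r IH]; first by rewrite !big_nil N0.
by rewrite !big_cons (le_trans (ND _ _)) // lerD2l.
Qed.

Lemma Nprod (I : Type) (r : seq I) (f : I -> C) :
  N (\prod_(i <- r) f i) = \prod_(i <- r) N (f i).
Proof. by elim: r => [|i r IH]; rewrite ?big_nil ?N1 // !big_cons NM IH. Qed.

End Norm.

(** * Unconditional sums *)

#[local] Existing Instance summability.totally_filter.

Section Summation.
Context {R : realType}.
Local Notation C := (R[i])%C.
Implicit Types (I J T : choiceType).

(** In [R[i]] only reals are comparable with 0, so the tolerances of its topology are exactly the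
    positive reals. *)
Lemma eps_posc (P : C -> Prop) :
  (forall e : R, 0 < e -> P (e%:C)%C) <-> (forall e : C, 0 < e -> P e).
Proof.
split=> H e e0; last by apply: H; rewrite ltcR.
have /complex_realP[k ek] : e \is Num.real by rewrite gtr0_real.
by move: e0; rewrite ek ltcR => k0; apply: H.
Qed.

Lemma has_sumP I (f : I -> C) (s : C) :
  has_sum f s <-> forall e : R, 0 < e -> exists A : {fset I},
    forall B : {fset I}, (A `<=` B)%fset -> N (\sum_(i <- B) f i - s) < e.
Proof.
rewrite /has_sum; split.
  move=> /cvgrPdist_lt/eps_posc H e /H [A _ AP]; exists A => B AB.
  by have := AP B AB; rewrite /summability.partial_sum /= big_seq_fsetE
    normE ltcR NBC.
move=> H; apply/cvgrPdist_lt/eps_posc => e /H[A AP].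
exists A => // B /AP.
by rewrite /summability.partial_sum /= big_seq_fsetE normE ltcR NBC.
Qed.

Lemma seq_cvgP (u : nat -> C) (l : C) :
  seq_cvg u l <->
  forall e : R, 0 < e -> exists n0, forall n, (n0 <= n)%N -> N (u n - l) < e.
Proof.
rewrite /seq_cvg; split.
  move=> /cvgrPdist_lt/eps_posc H e /H [n _ AP]; exists n => m nm.
  by have := AP m nm; rewrite normE ltcR NBC.
move=> H; apply/cvgrPdist_lt/eps_posc => e /H[A AP].
by exists A => // B /AP; rewrite normE ltcR NBC.
Qed.

Lemma small_eq0 (z : C) : (forall e : R, 0 < e -> N z < e) -> z = 0.
Proof.
move=> H; apply/eqP; rewrite -N_eq0; apply: contraT => nz.
have /H : 0 < N z by rewrite lt_neqAle eq_sym nz N_ge0.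
by rewrite ltxx.
Qed.

Lemma has_sum_uniq I (f : I -> C) s t : has_sum f s -> has_sum f t -> s = t.
Proof.
move=> /has_sumP fs /has_sumP ft; apply/eqP; rewrite -subr_eq0; apply/eqP.
apply: small_eq0 => e e0.
have e2 : 0 < e / 2 by lra.
have [A AP] := fs _ e2; have [B BP] := ft _ e2.
have := AP (A `|` B)%fset (fsubsetUl _ _).
have := BP (A `|` B)%fset (fsubsetUr _ _).
set S := bigop _ _ _ => h1 h2.
apply: le_lt_trans (Ntri S _ _) _; rewrite (NBC s); lra.
Qed.

Lemma eq_has_sum I (f g : I -> C) s : has_sum f s -> f =1 g -> has_sum g s.
Proof. by move=> fs /funext <-. Qed.

Lemma has_sumD I (f g : I -> C) s t :
  has_sum f s -> has_sum g t -> has_sum (fun i => f i + g i) (s + t).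
Proof.
move=> /has_sumP fs /has_sumP gt; apply/has_sumP => e e0.
have e2 : 0 < e / 2 by lra.
have [A AP] := fs _ e2; have [B BP] := gt _ e2.
exists (A `|` B)%fset => D; rewrite fsubUset => /andP[/AP h1 /BP h2].
rewrite big_split /= opprD addrACA.
by apply: le_lt_trans (ND _ _) _; lra.
Qed.

Lemma has_sumZ I (f : I -> C) s c :
  has_sum f s -> has_sum (fun i => c * f i) (c * s).
Proof.
move=> /has_sumP fs; apply/has_sumP => e e0.
have c1 : 0 < N c + 1 by have := N_ge0 c; lra.
have [|A AP] := fs (e / (N c + 1)); first by rewrite divr_gt0.
exists A => B /AP; rewrite -mulr_sumr -mulrBr NM ltr_pdivlMr // mulrC => h.
apply: le_lt_trans h; rewrite ler_wpM2r ?N_ge0 //; lra.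
Qed.

Definition dominated I (b : I -> R) : Prop :=
  exists M : R, forall A : {fset I}, \sum_(i <- A) b i <= M.

(** [A] nearly attains the supremum of the finite sums, so a finite set disjoint from it cannot add
    as much as [e]. *)
Lemma dominated_tail I (b : I -> R) : (forall i, 0 <= b i) -> dominated b ->
  forall e : R, 0 < e -> exists A : {fset I}, forall B : {fset I},
    (forall i, i \in B -> i \notin A) -> \sum_(i <- B) b i < e.
Proof.
move=> b0 [M bM] e e0.
pose S := [set x : R | exists A : {fset I}, x = \sum_(i <- A) b i]%classic.
have supS : has_sup S.
  split; first by exists (\sum_(i <- fset0) b i), fset0.
  by exists M => _ [A ->].
have [_ [A ->] hA] := sup_adherent e0 supS.
exists A => B BA.
have : \sum_(i <- (A `|` B)%fset) b i <= sup S.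
  by apply: ub_le_sup; [case: supS | exists (A `|` B)%fset].
rewrite (big_fsetID _ (mem A)) /=.
have -> : [fset x in (A `|` B) | x \in A]%fset = A.
  by apply/fsetP => x; rewrite !inE /=; case: (x \in A); rewrite ?andbF ?andbT.
have -> : [fset x in (A `|` B) | x \notin A]%fset = B.
  apply/fsetP => x; rewrite !inE /=; case: (boolP (x \in A)) => xA /=.
    by apply/esym/negP => /BA; rewrite xA.
  by rewrite ?andbT.
lra.
Qed.

Lemma dominated_le I (b b' : I -> R) :
  (forall i, b i <= b' i) -> dominated b' -> dominated b.
Proof.
move=> bb' [M bM]; exists M => A; apply: le_trans (bM A).
by apply: ler_sum => i _.
Qed.

Lemma dominatedZ I (b : I -> R) (c : R) : 0 <= c ->
  dominated b -> dominated (fun i => c * b i).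
Proof.
move=> c0 [M bM]; exists (c * M) => A.
by rewrite -mulr_sumr ler_wpM2l.
Qed.

Lemma has_sum_nneg I (b : I -> R) : (forall i, 0 <= b i) -> dominated b ->
  exists s : C, has_sum (fun i => (b i)%:C%C) s.
Proof.
move=> b0 bdom.
pose S := [set x : R | exists A : {fset I}, x = \sum_(i <- A) b i]%classic.
have supS : has_sup S.
  split; first by exists (\sum_(i <- fset0) b i), fset0.
  by case: bdom => M bM; exists M => _ [A ->].
exists ((sup S)%:C)%C; apply/has_sumP => e e0.
have [_ [A ->] hA] := sup_adherent e0 supS.
exists A => B AB.
have h1 : \sum_(i <- B) b i <= sup S by apply: ub_le_sup; [case: supS | exists B].
have h2 : \sum_(i <- A) b i <= \sum_(i <- B) b i.
  rewrite [leRHS](big_fsetID _ (mem A)) /=.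
  have -> : [fset x in B | x \in A]%fset = A.
    apply/fsetP => x; rewrite !inE /= andbC.
    by case: (boolP (x \in A)) => //= xA; apply: (fsubsetP AB).
  by rewrite lerDl sumr_ge0.
have -> : \sum_(i <- B) (b i)%:C%C - (sup S)%:C%C = ((\sum_(i <- B) b i - sup S)%:C)%C.
  by rewrite rmorphB /= rmorph_sum.
suff -> : N ((\sum_(i <- B) b i - sup S)%:C)%C = sup S - \sum_(i <- B) b i by lra.
apply: (@complexI R); rewrite -normE ler0_norm ?lecR ?subr_le0 //.
by rewrite -rmorphN opprB.
Qed.

Lemma Re_le_N (z : C) : `|complex.Re z| <= N z.
Proof. by have := normc_ge_Re z; rewrite normE lecR. Qed.

Lemma Im_le_N (z : C) : `|complex.Im z| <= N z.
Proof.
have := Re_le_N (z * 'i%C); rewrite ReiNIm normrN NM.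
suff -> : N ('i%C : C) = 1 by rewrite mulr1.
by rewrite /N /= expr0n /= add0r expr1n sqrtr1.
Qed.

Lemma has_sum_dominated I (f : I -> C) (b : I -> R) :
  (forall i, N (f i) <= b i) -> dominated b -> exists s, has_sum f s.
Proof.
move=> fb bdom.
have b0 i : 0 <= b i by apply: le_trans (fb i); exact: N_ge0.
have dom2 (g : I -> R) : (forall i, `|g i| <= N (f i)) ->
    dominated (fun i => b i + g i).
  move=> gf; apply: dominated_le (dominatedZ (ler0n _ 2) bdom) => i.
  have := le_trans (ler_norm _) (le_trans (gf i) (fb i)).
  lra.
have pos (g : I -> R) : (forall i, `|g i| <= N (f i)) ->
    forall i, 0 <= b i + g i.
  move=> gf i; have := le_trans (gf i) (fb i).
  by rewrite ler_norml => /andP[]; lra.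
have fRe i := Re_le_N (f i); have fIm i := Im_le_N (f i).
have [s0 h0] := has_sum_nneg b0 bdom.
have [s1 h1] := has_sum_nneg (pos _ fRe) (dom2 _ fRe).
have [s2 h2] := has_sum_nneg (pos _ fIm) (dom2 _ fIm).
(* [b + Re f] and [b + Im f] are non-negative and bounded by [2 b]; subtracting the sum of [b] again
   recovers the two parts of [f]. *)
exists ((s1 + -1 * s0) + 'i%C * (s2 + -1 * s0)).
have H := (has_sumD (has_sumD h1 (has_sumZ (c := -1) h0))
  (has_sumZ (c := 'i%C) (has_sumD h2 (has_sumZ (c := -1) h0)))).
apply: (eq_has_sum H).
move=> i.
by rewrite !mulN1r !rmorphD /= !(addrC (b i)%:C%C) !addrK -complexE.
Qed.

(** Injective reindexing and extension by zero in one statement: since [g] is a left inverse of [h],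
    [h (g i) != i] says that [i] lies outside the image of [h]. *)
Lemma has_sum_can I J (h : J -> I) (g : I -> J) (f : I -> C) s :
  cancel h g -> (forall i, h (g i) != i -> f i = 0) ->
  has_sum f s <-> has_sum (fun j => f (h j)) s.
Proof.
move=> hK f0; have hI := can_inj hK; split=> /has_sumP fs; apply/has_sumP.
  move=> e /fs [A AP]; exists [fset g x | x in A]%fset => B AB.
  have <- : \sum_(i <- ([fset h x | x in B] `|` A)%fset) f i = \sum_(i <- B) f (h i).
    rewrite -(big_fset_incl _ (fsubsetUl [fset h x | x in B]%fset A)).
      by rewrite big_imfset //= => x y _ _ /hI.
    move=> i; rewrite !inE => /orP[->//|iA] iB.
    apply: f0; apply: contra iB => /eqP <-.
    by apply/imfsetP; exists (g i) => //; apply/(fsubsetP AB)/imfsetP; exists i.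
  by apply/AP/fsubsetUr.
move=> e /fs [A AP]; exists [fset h x | x in A]%fset => B AB.
have <- : \sum_(j <- [fset g i | i in B & h (g i) == i]%fset) f (h j)
    = \sum_(i <- B) f i.
  rewrite big_imfset /=; last first.
    move=> x y /= /andP[_ /eqP xK] /andP[_ /eqP yK] gxy.
    by rewrite -xK gxy.
  rewrite big_filter big_mkcond; apply: eq_bigr => i _.
  by case: eqP => [->//|/eqP/f0].
apply: AP; apply/fsubsetP => j jA; apply/imfsetP; exists (h j); last by rewrite hK.
by rewrite !inE hK eqxx andbT; apply/(fsubsetP AB)/imfsetP; exists j.
Qed.

Lemma has_sum_fibres T I (pi : T -> I) (f : T -> C) (g : I -> C) s :
  has_sum f s ->
  (forall i, has_sum (fun t => if pi t == i then f t else 0) (g i)) ->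
  has_sum g s.
Proof.
move=> /has_sumP fs fg; apply/has_sumP => e e0.
have e2 : 0 < e / 2 by lra.
have [A AP] := fs _ e2; exists [fset pi x | x in A]%fset => B AB.
(* The tolerance is shared among the elements of [B]; the [+ 1] keeps it positive when [B] is
   empty. *)
pose d := e / 2 / ((size B)%:R + 1).
have d0 : 0 < d by rewrite divr_gt0 // ltr_pwDr.
have /choice[K KP] : forall i, exists K : {fset T}, forall D, (K `<=` D)%fset ->
    N (\sum_(t <- D) (if pi t == i then f t else 0) - g i) < d.
  by move=> i; have /has_sumP/(_ _ d0) := fg i.
(* One finite set that contains [A] and is large enough in each fibre over [B]; the cut by
   [pi t == i] prevents it from meeting other fibres. *)
pose D := (A `|` \bigcup_(i <- B) [fset t in K i | pi t == i])%fset.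
have DB t : t \in D -> pi t \in B.
  rewrite inE => /orP[tA|].
    by apply/(fsubsetP AB)/imfsetP; exists t.
  by case/bigfcupP => i /andP[iB _]; rewrite !inE => /andP[_ /eqP ->].
have fD : \sum_(t <- D) f t =
    \sum_(i <- B) \sum_(t <- D) (if pi t == i then f t else 0).
  rewrite exchange_big /= big_seq [RHS]big_seq; apply: eq_bigr => t tD.
  rewrite (big_fsetD1 (pi t)) ?DB //= eqxx big_seq big1 ?addr0 // => i.
  by rewrite !inE eq_sym => /andP[/negPf ->].
have step i : i \in B ->
    N (\sum_(t <- D) (if pi t == i then f t else 0) - g i) < d.
  move=> iB; have := KP i (D `|` K i)%fset (fsubsetUr _ _).
  rewrite -(big_fset_incl _ (fsubsetUl D (K i))) // => t.
  rewrite inE => /orP[->//|tK] tD; case: eqP => // tpi; case/negP: tD.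
  rewrite inE; apply/orP; right; apply/bigfcupP; exists i; rewrite ?iB //.
  by rewrite !inE tK tpi eqxx.
apply: le_lt_trans (Ntri (\sum_(t <- D) f t) _ _) _.
have h1 := AP D (fsubsetUl _ _).
suff : N (\sum_(i <- B) g i - \sum_(t <- D) f t) <= e / 2 by lra.
rewrite NBC fD -sumrB; apply: le_trans (Nsum _ _) _.
have : \sum_(i <- B) N (\sum_(t <- D) (if pi t == i then f t else 0) - g i)
    <= \sum_(i <- B) d.
  by rewrite big_seq [leRHS]big_seq; apply: ler_sum => i /step /ltW.
move/le_trans; apply; rewrite big_const_seq count_predT iter_addr addr0.
have <- : d * ((size B)%:R + 1) = e / 2.
  by rewrite divfK // gt_eqF // ltr_pwDr.
by rewrite mulrDr mulr1 mulr_natr lerDl ltW.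
Qed.

Lemma has_sum_fubini I J T (h : I -> J -> T) (pi : T -> I) (k : T -> J)
    (f : T -> C) (g : I -> C) s :
  (forall i j, pi (h i j) = i) -> (forall i j, k (h i j) = j) ->
  (forall t, h (pi t) (k t) = t) ->
  has_sum f s -> (forall i, has_sum (fun j => f (h i j)) (g i)) ->
  has_sum g s.
Proof.
move=> hpi hk hK fs fg; apply: (has_sum_fibres (pi := pi) fs) => i.
have z t : h i (k t) != t -> (if pi t == i then f t else 0) = 0.
  by move=> ne; case: eqP => // pit; move: ne; rewrite -pit hK eqxx.
apply: (proj2 (has_sum_can (g i) (hk i) z)).
by apply: (eq_has_sum (fg i)) => j; rewrite hpi eqxx.
Qed.

Lemma has_sum_fin I (f : I -> C) (r : seq I) : uniq r ->
  (forall i, i \notin r -> f i = 0) -> has_sum f (\sum_(i <- r) f i).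
Proof.
move=> ur f0; apply/has_sumP => e e0; exists [fset i in r]%fset => B rB.
rewrite -(big_fset_incl _ rB) /=; last first.
  by move=> i _; rewrite !inE => /f0.
rewrite (perm_big r) /= ?subrr ?N0 //.
by apply: uniq_perm => // i; rewrite !inE.
Qed.

Lemma seq_cvgD (u v : nat -> C) l m :
  seq_cvg u l -> seq_cvg v m -> seq_cvg (fun n => u n + v n) (l + m).
Proof. exact: cvgD. Qed.

Lemma seq_cvgM (u v : nat -> C) l m :
  seq_cvg u l -> seq_cvg v m -> seq_cvg (fun n => u n * v n) (l * m).
Proof. exact: cvgM. Qed.

Lemma seq_cvgV (u : nat -> C) l :
  l != 0 -> seq_cvg u l -> seq_cvg (fun n => (u n)^-1) l^-1.
Proof. exact: cvgV. Qed.

Lemma eq_seq_cvg (u v : nat -> C) l : seq_cvg u l -> u =1 v -> seq_cvg v l.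
Proof. by move=> ul /funext <-. Qed.

Lemma seq_cvg_cst (l : C) : seq_cvg (fun _ => l) l.
Proof. exact: cvg_cst. Qed.

Lemma seq_cvgX (u : nat -> C) l s :
  seq_cvg u l -> seq_cvg (fun n => u n ^+ s) (l ^+ s).
Proof.
move=> ul; elim: s => [|s IH]; first exact: (@seq_cvg_cst 1).
by rewrite exprS; apply: (eq_seq_cvg (seq_cvgM ul IH)) => n; rewrite exprS.
Qed.

Lemma seq_cvg_uniq (u : nat -> C) l m : seq_cvg u l -> seq_cvg u m -> l = m.
Proof. exact: (cvg_unique (@norm_hausdorff _ _)). Qed.

Lemma seq_cvg_fsum I (F : nat -> I -> C) (f : I -> C) (r : seq I) :
  (forall i, seq_cvg (F^~ i) (f i)) ->
  seq_cvg (fun n => \sum_(i <- r) F n i) (\sum_(i <- r) f i).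
Proof.
move=> Ff; elim: r => [|i r IH].
  rewrite big_nil; apply: (eq_seq_cvg (@seq_cvg_cst 0)) => n.
  by rewrite big_nil.
rewrite big_cons; apply: (eq_seq_cvg (seq_cvgD (Ff i) IH)) => n.
by rewrite big_cons.
Qed.

(** Dominated convergence for series: outside a finite set chosen from [b] everything is uniformly
    small, and inside it convergence is termwise. *)
Lemma tannery I (F : nat -> I -> C) (S : nat -> C) (f : I -> C) (b : I -> R) s :
  (forall n, has_sum (F n) (S n)) -> has_sum f s ->
  (forall n i, N (F n i) <= b i) -> dominated b ->
  (forall i, seq_cvg (F^~ i) (f i)) -> seq_cvg S s.
Proof.
move=> FS /has_sumP fs Fb bdom Ff; apply/seq_cvgP => e e0.
have b0 i : 0 <= b i by apply: le_trans (Fb 0%N i); exact: N_ge0.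
have e4 : 0 < e / 4 by lra.
have [A1 A1P] := dominated_tail b0 bdom e4; have [A2 A2P] := fs _ e4.
pose A := (A1 `|` A2)%fset.
have /seq_cvgP/(_ _ e4)[n0 n0P] := seq_cvg_fsum (r := A) Ff.
exists n0 => n /n0P h1; have h2 := A2P A (fsubsetUr _ _).
have /has_sumP/(_ _ e4)[B BP] := FS n.
have := BP (A `|` B)%fset (fsubsetUr _ _).
rewrite (big_fsetID _ (mem A)) /=.
have -> : [fset x in (A `|` B) | x \in A]%fset = A.
  by apply/fsetP => x; rewrite !inE /=; case: (x \in A1); case: (x \in A2);
    rewrite ?andbF ?andbT.
set D := [fset x in (A `|` B) | x \notin A]%fset.
have : \sum_(i <- D) b i < e / 4.
  apply: A1P => i; rewrite !inE /= negb_or => /andP[_ /andP[] //].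
have : N (\sum_(i <- D) F n i) <= \sum_(i <- D) b i.
  by apply: le_trans (Nsum _ _) _; apply: ler_sum.
move=> h3 h4 h5.
set a := \sum_(i <- A) F n i in h1 h5; set c := \sum_(i <- D) F n i in h3 h5.
set a' := \sum_(i <- A) f i in h1 h2.
have -> : S n - s = (S n - (a + c)) + c + (a - a') + (a' - s) by ring.
apply: le_lt_trans (ND _ _) _.
apply: le_lt_trans (lerD (ND _ _) (lexx _)) _.
apply: le_lt_trans (lerD (lerD (ND _ _) (lexx _)) (lexx _)) _.
rewrite (NBC (S n)); lra.
Qed.

End Summation.

(** * Dominating families *)

Section Bounds.
Context {R : realType}.

Lemma dominated_nat (b : nat -> R) (M : R) : (forall n, 0 <= b n) ->
  (forall n, \sum_(i < n) b i <= M) -> dominated b.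
Proof.
move=> b0 bM; exists M => A.
pose n := (\max_(i <- A) i.+1)%N.
have An i : i \in A -> (i < n)%N.
  by move=> iA; rewrite /n (big_fsetD1 i) //= leq_maxl.
apply: le_trans (bM n).
rewrite -(big_mkord xpredT) /= /index_iota subn0.
have -> : \sum_(i <- iota 0 n) b i = \sum_(i <- [fset i in iota 0 n]%fset) b i.
  apply: perm_big; apply: uniq_perm => [||i]; rewrite ?fset_uniq ?iota_uniq //.
  by rewrite !inE.
rewrite [leRHS](big_fsetID _ (mem A)) /=.
have -> : [fset x in [fset i in iota 0 n]%fset | x \in A]%fset = A.
  apply/fsetP => x; rewrite !inE mem_iota /= add0n andbC.
  by case: (boolP (x \in A)) => //= /An.
by rewrite lerDl sumr_ge0.
Qed.

Lemma dominated_geometric (r : R) : 0 <= r < 1 -> dominated (fun n : nat => r ^+ n).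
Proof.
move=> /andP[r0 r1]; apply: (@dominated_nat _ (1 - r)^-1) => [n|n].
  exact: exprn_ge0.
rewrite -[leRHS]mul1r ler_pdivlMr ?subr_gt0 // mulrC.
have := subrX1 r n; rewrite -opprB -[in RHS]opprB mulNr => /oppr_inj <-.
by rewrite lerBlDr lerDl exprn_ge0.
Qed.

Lemma dominated_pair (I J : choiceType) (a : I -> R) (b : J -> R) :
  (forall i, 0 <= a i) -> (forall j, 0 <= b j) -> dominated a -> dominated b ->
  dominated (fun p : I * J => a p.1 * b p.2).
Proof.
move=> a0 b0 [M aM] [M' bM]; exists (M * M') => A.
have M0 : 0 <= M' by have := bM fset0; rewrite big_nil.
rewrite (partition_big_imfset _ fst) /=.
apply: le_trans (_ : \sum_(i <- [fset p.1 | p in A]%fset) a i * M' <= _); last first.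
  by rewrite -mulr_suml ler_wpM2r.
apply: ler_sum => i _.
rewrite (eq_bigr (fun p => a i * b p.2)); last by move=> p /eqP ->.
rewrite -mulr_sumr ler_wpM2l //.
apply: le_trans (bM [fset p.2 | p in [fset p in A | p.1 == i]]%fset).
rewrite big_imfset /=; first by rewrite [leLHS]big_fset_condE.
by move=> [x y] [x' y'] /=; rewrite !inE /= => /andP[_ /eqP ->] /andP[_ /eqP ->] ->.
Qed.

(** Weierstrass's inequality: a product of factors 1 - x_k is at least 1 minus the sum of the x_k.
    From an index [m] where the tail sum is at most 1/2, the product never falls below half of
    [P m]. *)
Lemma prod_1subX_ge (r : R) : 0 <= r < 1 ->
  exists2 c : R, 0 < c & forall n, c <= \prod_(k < n) (1 - r ^+ k.+1).
Proof.
move=> /andP[r0 r1].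
have d0 : 0 < 1 - r by lra.
have f01 k : 0 < 1 - r ^+ k.+1 <= 1.
  by rewrite subr_gt0 exprn_ilt1 //= lerBlDr lerDl exprn_ge0.
have [m hm] : exists m, r ^+ m.+1 / (1 - r) <= 1 / 2.
  have [A HA] : exists A : {fset nat}, forall B : {fset nat}, (forall i, i \in B -> i \notin A) ->
      \sum_(i <- B) r ^+ i < (1 - r) / 2.
    have r01 : 0 <= r < 1 by rewrite r0.
    apply: (dominated_tail _ (dominated_geometric r01)); last lra.
    by move=> i; apply: exprn_ge0.
  pose m := (\max_(i <- A) i)%N.
  exists m; have := HA [fset m.+1]%fset; rewrite big_seq_fset1 => h.
  rewrite ler_pdivrMr // mulrC mulrA mulr1 ltW // h // => i.
  rewrite inE => /eqP ->; apply/negP => /= mA.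
  suff : (m.+1 <= m)%N by rewrite ltnn.
  by rewrite {2}/m (big_fsetD1 m.+1) //= leq_maxl.
pose P n := \prod_(k < n) (1 - r ^+ k.+1).
have P0 n : 0 < P n by apply: prodr_gt0 => k _; case/andP: (f01 k).
have Pm n : P m * (1 - r ^+ m.+1 * (1 - r ^+ n) / (1 - r)) <= P (m + n)%N.
  elim: n => [|n IH]; first by rewrite expr0 subrr mulr0 mul0r subr0 mulr1 addn0.
  rewrite addnS {2}/P big_ord_recr /= -/(P _).
  have /andP[g0 g1] := f01 (m + n)%N.
  have h : P m * (1 - r ^+ m.+1 * (1 - r ^+ n) / (1 - r)) * (1 - r ^+ (m + n).+1)
     <= P (m + n)%N * (1 - r ^+ (m + n).+1) by rewrite ler_pM2r.
  apply: le_trans h; rewrite -[leRHS]mulrA ler_pM2l //.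
  have -> : r ^+ m.+1 * (1 - r ^+ n.+1) / (1 - r)
      = r ^+ m.+1 * (1 - r ^+ n) / (1 - r) + r ^+ (m + n).+1.
    rewrite -addSn exprD (exprS r n); field; lra.
  set a := _ / _; set x := r ^+ _.
  have a0 : 0 <= a.
    rewrite /a !mulr_ge0 ?exprn_ge0 ?invr_ge0 ?(ltW d0) //.
    by rewrite subr_ge0 exprn_ile1 // ltW.
  have x0 : 0 <= x by apply: exprn_ge0.
  nra.
exists (P m / 2); first by rewrite divr_gt0.
move=> n; rewrite -/(P n).
have Pdecr k l : P (k + l)%N <= P k.
  elim: l => [|l IH]; rewrite ?addn0 // addnS {1}/P big_ord_recr /= -/(P _).
  by apply: le_trans IH; rewrite ler_piMr ?(ltW (P0 _)) //; case/andP: (f01 (k + l)%N).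
apply: le_trans (Pdecr n m); rewrite addnC.
apply: le_trans (Pm n); rewrite ler_pM2l // .
have : r ^+ m.+1 * (1 - r ^+ n) / (1 - r) <= r ^+ m.+1 / (1 - r).
  rewrite mulrAC ler_piMr ?lerBlDr ?lerDl ?exprn_ge0 //.
  by rewrite divr_ge0 ?exprn_ge0 // ltW.
lra.
Qed.

(** From an index [m] with [r ^+ m * L <= 1 / 2] on, each factor at least halves the product; [K]
    bounds twice any of the earlier factors. *)
Lemma prod_geometric_le (r L : R) : 0 <= r < 1 -> 0 <= L ->
  exists M : R, forall n, \prod_(k < n) (r ^+ k * L) <= M * 2^-1 ^+ n.
Proof.
move=> /andP[r0 r1] L0.
have [m hm] : exists m, r ^+ m * L <= 1 / 2.
  have L1 : 0 < L + 1 by lra.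
  have [A HA] : exists A : {fset nat}, forall B : {fset nat}, (forall i, i \in B -> i \notin A) ->
      \sum_(i <- B) r ^+ i < 1 / 2 / (L + 1).
    have r01 : 0 <= r < 1 by rewrite r0.
    apply: (dominated_tail _ (dominated_geometric r01)); last by rewrite divr_gt0.
    by move=> i; apply: exprn_ge0.
  pose m := (\max_(i <- A) i).+1.
  exists m; have := HA [fset m]%fset; rewrite big_seq_fset1 => h.
  have {}h : r ^+ m < 1 / 2 / (L + 1).
    apply: h => i; rewrite inE => /eqP ->; apply/negP => /= mA.
    suff : (m <= m.-1)%N by rewrite ltnn.
    by rewrite [m.-1]/= (big_fsetD1 m) //= leq_maxl.
  move: h; rewrite ltr_pdivlMr // => h; have := exprn_ge0 m r0; nra.
pose K := 1 + 2 * L.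
have K1 : 1 <= K by rewrite lerDl; lra.
exists (K ^+ m) => n.
rewrite exprVn ler_pdivlMr ?exprn_gt0 //.
have -> : \prod_(k < n) (r ^+ k * L) * 2 ^+ n = \prod_(k < n) (r ^+ k * L * 2).
  by rewrite [RHS]big_split /= prodr_const card_ord.
have f0 k : 0 <= r ^+ k * L * 2 by rewrite !mulr_ge0 // exprn_ge0.
have [nm|mn] := leqP n m.
  apply: (@le_trans _ _ (K ^+ n)); last by rewrite ler_weXn2l.
  rewrite -[n in K ^+ n]card_ord -prodr_const; apply: ler_prod => k _.
  rewrite f0 /K; have := exprn_ile1 k r0 (ltW r1); nra.
have H l : \prod_(k < m + l) (r ^+ k * L * 2) <= K ^+ m.
  elim: l => [|l IH].
    rewrite addn0 -[m in K ^+ m]card_ord -prodr_const; apply: ler_prod => k _.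
    rewrite f0 /K; have := exprn_ile1 k r0 (ltW r1); nra.
  rewrite addnS big_ord_recr /=; apply: le_trans IH; rewrite ler_piMr //.
    by apply: prodr_ge0.
  rewrite exprD; have := exprn_ile1 l r0 (ltW r1); have := exprn_ge0 l r0.
  have := exprn_ge0 m r0.
  by nra.
by have := H (n - m)%N; rewrite subnKC // ltnW.
Qed.

End Bounds.

(** * Euler's identity and a limiting q-Gauss sum *)

Section QSeries.
Context {R : realType}.
Local Notation C := (R[i])%C.
Variable q : C.
Hypothesis q1 : N q < 1.

Let q01 : 0 <= N q < 1. Proof. by rewrite N_ge0. Qed.

Lemma qpochS (K : numFieldType) (a b : K) n :
  qpoch a b n.+1 = qpoch a b n * (1 - a * b ^+ n).
Proof. by rewrite /qpoch big_ord_recr. Qed.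

Lemma qpoch0 (K : numFieldType) (a b : K) : qpoch a b 0 = 1.
Proof. by rewrite /qpoch big_ord0. Qed.

Lemma qpoch_recl (K : numFieldType) (a b : K) n :
  qpoch a b n.+1 = (1 - a) * qpoch (a * b) b n.
Proof.
rewrite /qpoch big_ord_recl expr0 mulr1; congr (_ * _).
by apply: eq_bigr => k _; rewrite /= exprS mulrA.
Qed.

Lemma qpochqq_ge : exists2 c : R, 0 < c & forall n, c <= N (qpoch q q n).
Proof.
have [c c0 cP] := prod_1subX_ge q01; exists c => // n.
apply: le_trans (cP n) _; rewrite /qpoch Nprod; apply: ler_prod => k _.
have h : N q ^+ k.+1 <= 1 by rewrite exprn_ile1 ?N_ge0 // ltW.
rewrite subr_ge0 h -exprS /=.
have := ND (1 - q ^+ k.+1) (q ^+ k.+1); rewrite subrK N1 NX; lra.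
Qed.

Lemma qpochqq_neq0 n : qpoch q q n != 0.
Proof. by have [c c0 cP] := qpochqq_ge; rewrite -N_gt0 (lt_le_trans c0). Qed.

Lemma one_sub_qX_neq0 n : 1 - q ^+ n.+1 != 0.
Proof.
have := qpochqq_neq0 n.+1; rewrite qpochS -exprS.
by rewrite mulf_eq0 negb_or => /andP[].
Qed.

Lemma seq_cvg_expr (z : C) : N z < 1 -> seq_cvg (fun n => z ^+ n) 0.
Proof.
move=> z1; apply/seq_cvgP => e e0.
have r01 : 0 <= N z < 1 by rewrite N_ge0.
have [A HA] := dominated_tail (fun n => exprn_ge0 n (N_ge0 z))
  (dominated_geometric r01) e0.
exists (\max_(i <- A) i).+1 => n An; rewrite subr0 NX.
have := HA [fset n]%fset; rewrite big_seq_fset1; apply => i.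
rewrite inE => /eqP ->; apply/negP => nA; move: An; rewrite ltnNge => /negP; apply.
by rewrite (big_fsetD1 n) //= leq_maxl.
Qed.

Lemma dominated_prod (L c : R) : 0 <= L -> 0 <= c ->
  dominated (fun s => c * \prod_(k < s) (N q ^+ k * L)).
Proof.
move=> L0 c0; have [M hM] := prod_geometric_le q01 L0.
have M0 : 0 <= M by have := hM 0%N; rewrite big_ord0 expr0 mulr1; lra.
apply: dominatedZ => //; apply: dominated_le hM _; apply: dominatedZ => //.
by apply: dominated_geometric; lra.
Qed.

Definition euler_term (z : C) (s : nat) : C :=
  (\prod_(k < s) (q ^+ k * - z)) / qpoch q q s.

Lemma euler_termZ (z w : C) s : euler_term (z * w) s = w ^+ s * euler_term z s.
Proof.
rewrite /euler_term mulrA; congr (_ / _).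
rewrite -[s in w ^+ s]card_ord -prodr_const -big_split /=.
by apply: eq_bigr => k _; ring.
Qed.

Lemma N_prod_le (b : nat -> C) (L : R) s : (forall k, N (b k) <= L) ->
  N (\prod_(k < s) (q ^+ k * b k)) <= \prod_(k < s) (N q ^+ k * L).
Proof.
move=> bL; rewrite Nprod; apply: ler_prod => k _; rewrite N_ge0 NM NX /=.
by rewrite ler_wpM2l ?exprn_ge0 ?N_ge0.
Qed.

Lemma N_div_le (x y : C) (X c : R) : 0 < c -> N x <= X -> c <= N y ->
  N (x / y) <= c^-1 * X.
Proof.
move=> c0 xX cy; rewrite NM NV mulrC.
by rewrite ler_pM ?invr_ge0 ?N_ge0 // lef_pV2 ?posrE // (lt_le_trans c0).
Qed.

Lemma euler_term_sum z : exists s, has_sum (euler_term z) s.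
Proof.
have [c c0 cP] := qpochqq_ge.
apply: (has_sum_dominated (b := fun s => c^-1 * \prod_(k < s) (N q ^+ k * N z))).
  move=> s; apply: N_div_le => //.
  by apply: (N_prod_le (b := fun=> - z)) => k; rewrite NN.
by apply: dominated_prod; rewrite ?N_ge0 ?invr_ge0 ?ltW.
Qed.

Lemma has_sum_shift (f : nat -> C) s : f 0%N = 0 ->
  has_sum f s <-> has_sum (fun n => f n.+1) s.
Proof. by move=> f0; apply: (has_sum_can (g := predn)) => // -[|n] //; rewrite eqxx. Qed.

Lemma seq_cvg_eventually (u v : nat -> C) l n0 :
  (forall n, (n0 <= n)%N -> u n = v n) -> seq_cvg u l -> seq_cvg v l.
Proof.
move=> uv /seq_cvgP ul; apply/seq_cvgP => e /ul[m mP].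
exists (maxn n0 m) => n; rewrite geq_max => /andP[n0n mn].
by rewrite -uv // mP.
Qed.

(** [qpoch_inf] is a [lim], informative only once convergence is known. Euler's series [E] gives
    convergence and value together: from [E w = (1 - w) * E (w * q)] follows
    [E z = qpoch z q n * E (z * q ^+ n)], and the last factor tends to [E 0 = 1]. *)
Lemma euler_term_cvg z s :
  has_sum (euler_term z) s -> seq_cvg (qpoch z q) s.
Proof.
have /choice[E EP] := euler_term_sum.
move=> zs; have {s zs} -> : s = E z by apply: has_sum_uniq zs _.
have step w : E w = (1 - w) * E (w * q).
  suff : E w + -1 * E (w * q) = - w * E (w * q)     by rewrite mulN1r => /eqP; rewrite subr_eq => /eqP ->; ring.
  apply: has_sum_uniq (has_sumD (EP w) (has_sumZ (c := -1) (EP (w * q)))) _.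
  apply/has_sum_shift.
    by rewrite /euler_term !big_ord0 mulN1r subrr.
  apply: (eq_has_sum (has_sumZ (c := - w) (EP (w * q)))) => n.
  rewrite !euler_termZ mulN1r -[X in X - _]mul1r -mulrBl /euler_term qpochS.
  rewrite big_ord_recl /= expr0 mul1r -exprS.
  have -> : \prod_(i < n) (q ^+ bump 0 i * - w) = q ^+ n * \prod_(i < n) (q ^+ i * - w).
    rewrite -[n in q ^+ n]card_ord -prodr_const -big_split /=.
    by apply: eq_bigr => i _; rewrite exprS mulrA.
  by field; rewrite one_sub_qX_neq0 qpochqq_neq0.
have iter n : E z = qpoch z q n * E (z * q ^+ n).
  elim: n => [|n ->]; first by rewrite qpoch0 mul1r expr0 mulr1.
  by rewrite qpochS [E (z * q ^+ n)]step exprSr !mulrA.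
have E0 : has_sum (euler_term 0) 1.
  have := has_sum_fin (f := euler_term 0) (r := [:: 0%N]) isT.
  rewrite big_seq1 /euler_term big_ord0 qpoch0 divr1; apply => -[|n] // _.
  by rewrite big_ord_recl oppr0 mulr0 !mul0r.
have lim1 : seq_cvg (fun n => E (z * q ^+ n)) 1.
  have [c c0 cP] := qpochqq_ge.
  apply: (tannery (b := fun s => c^-1 * \prod_(k < s) (N q ^+ k * N z))
    (fun n => EP (z * q ^+ n)) E0).
  - move=> n s; apply: N_div_le => //.
    apply: (N_prod_le (b := fun=> - (z * q ^+ n))) => k.
    rewrite NN NM ler_piMr ?N_ge0 // NX exprn_ile1 ?N_ge0 //.
    exact: ltW.
  - by apply: dominated_prod; rewrite ?N_ge0 ?invr_ge0 ?ltW.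
  - move=> s; rewrite -(mulr0 z) euler_termZ.
    have := seq_cvgM (seq_cvgX (s := s) (seq_cvg_expr q1)) (@seq_cvg_cst R (euler_term z s)).
    by move/eq_seq_cvg; apply => n; rewrite euler_termZ.
have /seq_cvgP/(_ 1 ltr01)[n0 n0P] := lim1.
rewrite -[E z]mulr1 -[X in _ * X]invr1.
have := seq_cvgM (@seq_cvg_cst R (E z)) (seq_cvgV (oner_neq0 _) lim1).
apply: seq_cvg_eventually (n0) _ => n /n0P h.
rewrite (iter n) mulfK //; apply: contraTneq h => ->.
by rewrite add0r NN N1 ltxx.
Qed.

Lemma seq_cvg_lim (K : numFieldType) (u : nat -> K) l :
  seq_cvg u l -> (lim (u n @[n --> \oo]))%classic = l.
Proof. by apply: cvg_lim; exact: norm_hausdorff. Qed.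

Lemma euler_sum z : has_sum (euler_term z) (qpoch_inf z q).
Proof.
have [s zs] := euler_term_sum z.
by rewrite /qpoch_inf (seq_cvg_lim (euler_term_cvg zs)).
Qed.

Lemma qpoch_cvg z : seq_cvg (qpoch z q) (qpoch_inf z q).
Proof. by apply: euler_term_cvg; exact: euler_sum. Qed.

Lemma qpochqq_inf_neq0 : qpoch_inf q q != 0.
Proof.
have [c c0 cP] := qpochqq_ge.
apply/eqP => h; have := @qpoch_cvg q; rewrite h => /seq_cvgP/(_ _ c0)[n nP].
by have := nP n (leqnn n); rewrite subr0 ltNge cP.
Qed.

Lemma qpoch_inf_recl z : qpoch_inf z q = (1 - z) * qpoch_inf (z * q) q.
Proof.
apply: seq_cvg_uniq (seq_cvgM (@seq_cvg_cst R (1 - z)) (@qpoch_cvg (z * q))).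
have /seq_cvgP h := @qpoch_cvg z; apply/seq_cvgP => e /h[n0 n0P].
by exists n0 => n nn0; rewrite -qpoch_recl n0P // ltnW.
Qed.

Lemma qpoch_inf_split z n : qpoch_inf z q = qpoch z q n * qpoch_inf (z * q ^+ n) q.
Proof.
elim: n => [|n ->]; first by rewrite qpoch0 mul1r expr0 mulr1.
by rewrite qpochS qpoch_inf_recl exprSr !mulrA.
Qed.

(** The q-shifted factorial (q^(d+1)/z; q)_s with its powers of z cleared, so that z = 0 is allowed;
    there the term is q^(s^2 + d s) / ((q; q)_s (q; q)_(s+d)), as in the count of partitions by
    Durfee rectangles. The triple product uses that case. *)
Definition durfee_term (z : C) (d s : nat) : C :=
  (\prod_(k < s) (q ^+ k * (q ^+ (d + k).+1 - z)))
    / (qpoch q q s * qpoch q q (s + d)).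

Lemma N_durfee_term_le z : exists2 c : R, 0 <= c & forall d s,
  N (durfee_term z d s) <= c * \prod_(k < s) (N q ^+ k * (1 + N z)).
Proof.
have [c c0 cP] := qpochqq_ge; exists (c * c)^-1.
  by rewrite invr_ge0 mulr_ge0 ?ltW.
move=> d s; apply: N_div_le; first by rewrite mulr_gt0.
  apply: (N_prod_le (b := fun k => q ^+ (d + k).+1 - z)) => k.
  apply: le_trans (NB _ _) _; rewrite lerD2r NX.
  by rewrite exprn_ile1 ?N_ge0 ?ltW.
by rewrite NM ler_pM ?cP // ltW.
Qed.

(* A limiting case of the q-Gauss sum. The sum does not depend on d, because the
   difference of two consecutive ones telescopes; for d -> oo it is Euler's sum. *)
Lemma durfee_sum z d :
  has_sum (durfee_term z d) (qpoch_inf z q / qpoch_inf q q).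
Proof.
have [c c0 cP] := N_durfee_term_le z.
have L0 : 0 <= 1 + N z by have := N_ge0 z; lra.
have dom := dominated_prod L0 c0.
have /choice[K KP] : forall d, exists s, has_sum (durfee_term z d) s.
  by move=> e; exact: has_sum_dominated (cP e) dom.
have KS e : K e.+1 = K e.
  (* Telescoping certificate: the difference of the terms for [e] and [e.+1] at [s] is
     [H s.+1 - H s]. As [H 0 = 0], the series of [H] and its shift have the same sum. *)
  pose H s := if s is s'.+1 then - q ^+ (e + s').+1 * durfee_term z e.+1 s' else 0.
  have [h hP] : exists h, has_sum (fun s => H s.+1) h.
    apply: has_sum_dominated dom => s; apply: le_trans (cP e.+1 s).
    by rewrite /H NM NN NX ler_piMl ?N_ge0 ?exprn_ile1 ?N_ge0 ?ltW.
  have hP' : has_sum H h by apply/has_sum_shift.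
  suff : K e + -1 * K e.+1 = h + -1 * h     by rewrite !mulN1r subrr => /subr0_eq ->.
  apply: has_sum_uniq (has_sumD (KP e) (has_sumZ (c := -1) (KP e.+1))) _.
  apply: (eq_has_sum (has_sumD hP (has_sumZ (c := -1) hP'))) => -[|s].
    rewrite /H /durfee_term !big_ord0 !qpoch0 !mul1r !add0n mulr0 addr0 addn0.
    rewrite qpochS -exprS.
    by field; rewrite one_sub_qX_neq0 qpochqq_neq0.
  rewrite /H /durfee_term.
  set X := \prod_(i < s) (q ^+ i * (q ^+ (e.+1 + i).+1 - z)).
  have -> : \prod_(k < s.+1) (q ^+ k * (q ^+ (e + k).+1 - z)) =
      (q ^+ e.+1 - z) * (q ^+ s * X).
    rewrite big_ord_recl /= expr0 mul1r addn0; congr (_ * _).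
    rewrite /X -[s in q ^+ s]card_ord -prodr_const -big_split /=.
    by apply: eq_bigr => i _; rewrite /bump /= add1n (exprS q i) addnS -mulrA.
  have -> : \prod_(k < s.+1) (q ^+ k * (q ^+ (e.+1 + k).+1 - z)) =
      X * (q ^+ s * (q ^+ (e.+1 + s).+1 - z)).
    by rewrite big_ord_recr.
  rewrite !addSn !addnS !qpochS -!exprS !(addnC s e).
  move: X => X.
  have h1 := one_sub_qX_neq0 s; have h2 := one_sub_qX_neq0 (e + s).
  have h3 := one_sub_qX_neq0 (e + s).+1.
  have h4 := qpochqq_neq0 s; have h5 := qpochqq_neq0 (e + s).
  move: (qpoch q q s) (qpoch q q (e + s)) h4 h5 => u v h4 h5.
  move: h1 h2 h3; rewrite !exprS !exprD => h1 h2 h3.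
  move: (q ^+ s) (q ^+ e) h1 h2 h3 => a b h1 h2 h3.
  by field; rewrite h1 h2 h3 h4 h5.
have K0 e : K e = K 0%N by elim: e => // e <-.
have -> : qpoch_inf z q / qpoch_inf q q = K d; last exact: KP.
rewrite K0; apply: (seq_cvg_uniq (u := fun _ => K 0%N)); last exact: seq_cvg_cst.
apply: (eq_seq_cvg (u := K)) => //; rewrite mulrC.
apply: (tannery KP (has_sumZ (c := (qpoch_inf q q)^-1) (@euler_sum z)) _ dom).
  by move=> n s; exact: cP.
move=> s; rewrite /durfee_term /euler_term.
have -> : (qpoch_inf q q)^-1 * ((\prod_(k < s) (q ^+ k * - z)) / qpoch q q s) =
  (\prod_(k < s) (q ^+ k * - z)) * (qpoch q q s * qpoch_inf q q)^-1.
  by rewrite invfM; ring.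
apply: seq_cvgM; last first.
  apply: seq_cvgV; first by rewrite mulf_neq0 ?qpochqq_neq0 ?qpochqq_inf_neq0.
  apply: seq_cvgM (@seq_cvg_cst R _) _.
  have /seq_cvgP h := @qpoch_cvg q; apply/seq_cvgP => e /h[n0 n0P].
  by exists n0 => n nn0; apply: n0P; apply: leq_trans (leq_addl _ _).
elim: s => [|s IH].
  by rewrite big_ord0; apply: (eq_seq_cvg (@seq_cvg_cst R 1)) => n; rewrite big_ord0.
suff h : seq_cvg (fun n => q ^+ s * (q ^+ (n + s).+1 - z)) (q ^+ s * - z).
  rewrite big_ord_recr /=; apply: (eq_seq_cvg (seq_cvgM IH h)) => n.
  by rewrite big_ord_recr.
apply: seq_cvgM (@seq_cvg_cst R _) _.
suff h : seq_cvg (fun n => q ^+ (n + s).+1) 0.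
  by have := seq_cvgD h (@seq_cvg_cst R (- z)); rewrite add0r.
have /seq_cvgP h := seq_cvg_expr q1; apply/seq_cvgP => e /h[n0 n0P].
by exists n0 => n nn0; apply: n0P; rewrite -addnS (leq_trans nn0) ?leq_addr.
Qed.

End QSeries.

(** * Sums over diagonals and antidiagonals *)

Section DoubleSums.
Context {R : realType}.
Local Notation C := (R[i])%C.

Lemma has_sum_diagonals (f : nat * nat -> C) (g : int -> C) s :
  has_sum f s ->
  (forall n : nat, has_sum (fun s => f (s + n, s)%N) (g n)) ->
  (forall n : nat, has_sum (fun s => f (s, s + n)%N) (g (- n%:Z))) ->
  has_sum g s.
Proof.
move=> fs gpos gneg.
pose h (d : int) (s : nat) : nat * nat :=
  if 0 <= d then (s + `|d|, s)%N else (s, s + `|d|)%N.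
apply: (has_sum_fubini (h := h) (pi := fun p => p.1%:Z - p.2%:Z)
  (k := fun p => minn p.1 p.2) _ _ _ fs).
- by move=> d t; rewrite /h; case: ifP => d0 /=; lia.
- by move=> d t; rewrite /h; case: ifP => d0 /=; lia.
- by move=> [j k]; rewrite /h /=; case: ifP => d0; congr (_, _); lia.
move=> [n|n]; first exact: gpos.
by have := gneg n.+1; rewrite -NegzE => /eq_has_sum; apply.
Qed.

Lemma has_sum_antidiagonals (f : nat * nat -> C) s :
  has_sum f s -> has_sum (fun n => \sum_(j < n.+1) f (j : nat, n - j)%N) s.
Proof.
move=> fs; apply: (has_sum_fibres (pi := fun p => (p.1 + p.2)%N) fs) => n.
pose r := [seq (j, n - j)%N | j <- iota 0 n.+1].
have -> : \sum_(j < n.+1) f (j : nat, n - j)%N =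
    \sum_(t <- r) (if (t.1 + t.2 == n)%N then f t else 0).
  rewrite big_map -(big_mkord xpredT (fun j => f (j, n - j)%N)) /index_iota subn0.
  rewrite big_seq [RHS]big_seq; apply: eq_bigr => j; rewrite mem_iota => jn /=.
  by rewrite ifT //; lia.
apply: has_sum_fin.
  by rewrite map_inj_uniq ?iota_uniq // => a b [].
move=> [j k]; case: eqP => //= jkn /mapP; case; exists j.
  by rewrite mem_iota; lia.
by congr (_, _); lia.
Qed.

Lemma has_sum_mul (I J : choiceType) (f : I -> C) (g : J -> C) (a : I -> R) (b : J -> R) s t :
  (forall i, N (f i) <= a i) -> (forall j, N (g j) <= b j) ->
  dominated a -> dominated b -> has_sum f s -> has_sum g t ->
  has_sum (fun p : I * J => f p.1 * g p.2) (s * t).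
Proof.
move=> fa gb da db fs gt.
have a0 i : 0 <= a i by apply: le_trans (fa i); exact: N_ge0.
have b0 j : 0 <= b j by apply: le_trans (gb j); exact: N_ge0.
have [u hu] : exists u, has_sum (fun p : I * J => f p.1 * g p.2) u.
  apply: has_sum_dominated (dominated_pair a0 b0 da db) => p.
  by rewrite NM ler_pM ?N_ge0.
have h : has_sum (fun i => f i * t) u.
  apply: (has_sum_fubini (h := fun i j => (i, j)) (pi := fst) (k := snd)
    (f := fun p => f p.1 * g p.2) _ _ _ hu).
  - by [].
  - by [].
  - by case.
  by move=> i; exact: (has_sumZ (c := f i) gt).
have -> : s * t = u; last exact: hu.
rewrite mulrC; apply: has_sum_uniq _ h.
by apply: (eq_has_sum (has_sumZ (c := t) fs)) => i; rewrite mulrC.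
Qed.

End DoubleSums.

(** * The Jacobi triple product *)

Section Jacobi.
Context {R : realType}.
Local Notation C := (R[i])%C.

Lemma NX_lt1 (q : C) n : N q < 1 -> N (q ^+ n.+1) < 1.
Proof. by move=> q1; rewrite NX exprn_ilt1 ?N_ge0. Qed.

Lemma qpoch_inf0 (q : C) : N q < 1 -> qpoch_inf 0 q = 1.
Proof.
move=> q1; apply: (seq_cvg_uniq (@qpoch_cvg _ _ q1 0)).
apply: (eq_seq_cvg (@seq_cvg_cst R 1)) => n.
by rewrite /qpoch big1 // => k _; rewrite mul0r subr0.
Qed.

Lemma euler_term_bound (q z : C) : N q < 1 ->
  exists2 b, dominated b & forall s, N (euler_term q z s) <= b s.
Proof.
move=> q1; have [c c0 cP] := qpochqq_ge q1.
exists (fun s => c^-1 * \prod_(k < s) (N q ^+ k * N z)).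
  by apply: dominated_prod; rewrite ?N_ge0 ?invr_ge0 ?ltW.
move=> s; apply: N_div_le => //.
by apply: (@N_prod_le _ q (fun=> - z)) => k; rewrite NN.
Qed.

(** Passing to the base p^2 completes Euler's exponent s (s - 1) / 2 to a square, which is what
    makes the two factors of the triple product combine. *)
Lemma euler_term_sq (p x : C) s : p != 0 ->
  euler_term (p ^+ 2) (- (p * x)) s = p ^ (s%:Z * s%:Z) * x ^ s%:Z / qpoch (p ^+ 2) (p ^+ 2) s.
Proof.
move=> p0; rewrite /euler_term; congr (_ / _).
elim: s => [|s IH]; first by rewrite big_ord0 mulr0 !expr0z mulr1.
rewrite big_ord_recr /= IH opprK -exprM exprSz.
have -> : p ^ (s.+1%:Z * s.+1%:Z) = p ^ (s%:Z * s%:Z) * p ^+ (2 * s) * p.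
  by rewrite exprnP -[X in _ = _ * X]expr1z -!expfzDr //; congr (_ ^ _); lia.
ring.
Qed.

(* Expand the two theta factors by Euler's sum and collect along the diagonals
   j - k = d: each of them sums to 1 / (p^2; p^2)_oo. *)
Lemma jacobi_triple_product (p z : C) : N p < 1 -> p != 0 -> z != 0 ->
  has_sum (fun d : int => p ^ (d * d) * z ^ d)
    (qpoch_inf (- (p * z)) (p ^+ 2) * qpoch_inf (- (p / z)) (p ^+ 2)
       * qpoch_inf (p ^+ 2) (p ^+ 2)).
Proof.
move=> p1 p0 z0; have P1 : N (p ^+ 2) < 1 by exact: NX_lt1.
set P := p ^+ 2 in P1 *; set S := _ * qpoch_inf (- (p / z)) P.
have E0 := qpochqq_inf_neq0 P1.
have diag (x : C) n : x != 0 -> has_sum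
    (fun s => euler_term P (- (p * x)) (s + n)%N * euler_term P (- (p / x)) s)
    ((qpoch_inf P P)^-1 * (p ^ (n%:Z * n%:Z) * x ^ n%:Z)).
  move=> x0; set c := p ^ (n%:Z * n%:Z) * x ^ n%:Z.
  have -> : (qpoch_inf P P)^-1 * c = c * (qpoch_inf 0 P / qpoch_inf P P).
    by rewrite (qpoch_inf0 P1) div1r mulrC.
  apply: (eq_has_sum (has_sumZ (c := c) (@durfee_sum _ _ P1 0 n))) => s.
  rewrite (euler_term_sq x _ p0) (euler_term_sq x^-1 _ p0) -/P /c {c} /durfee_term.
  have -> : \prod_(k < s) (P ^+ k * (P ^+ (n + k).+1 - 0)) = p ^ (2 * (s%:Z * s%:Z + s%:Z * n%:Z)).
    elim: s => [|s IH]; first by rewrite big_ord0 mul0r addr0 mulr0 expr0z.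
    rewrite big_ord_recr /= IH subr0 /P -!exprM !exprnP -!expfzDr //; congr (_ ^ _); lia.
  have -> : p ^ ((s + n)%N%:Z * (s + n)%N%:Z) * x ^ (s + n)%N%:Z / qpoch P P (s + n)
       * (p ^ (s%:Z * s%:Z) * x^-1 ^ s%:Z / qpoch P P s)
     = (p ^ ((s + n)%N%:Z * (s + n)%N%:Z) * p ^ (s%:Z * s%:Z)) * (x ^ (s + n)%N%:Z * x^-1 ^ s%:Z)
       / (qpoch P P s * qpoch P P (s + n)) by rewrite invfM; ring.
  rewrite mulrA; congr (_ / _).
  rewrite exprz_inv -(expfzDr _ _ p0) -(expfzDr _ _ x0) mulrAC -(expfzDr _ _ p0).
  by congr (_ ^ _ * _ ^ _); lia.
have [b db bP] := euler_term_bound (- (p * z)) P1.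
have [b' db' bP'] := euler_term_bound (- (p / z)) P1.
have FS := has_sum_mul bP bP' db db' (@euler_sum _ _ P1 _) (@euler_sum _ _ P1 _).
have H : has_sum (fun d : int => (qpoch_inf P P)^-1 * (p ^ (d * d) * z ^ d)) S.
  apply: (has_sum_diagonals FS) => n /=; first exact: diag.
  have := diag z^-1 n (invr_neq0 z0); rewrite invrK mulrNN exprz_inv.
  by move=> /eq_has_sum; apply => s; rewrite mulrC.
rewrite mulrC; apply: (eq_has_sum (has_sumZ (c := qpoch_inf P P) H)) => d.
by rewrite mulrA divff // mul1r.
Qed.

End Jacobi.

(** * Reduction of the triple sum *)

Section TripleSum.
Context {R : realType}.
Local Notation C := (R[i])%C.
Variable q : C.
Hypotheses (q1 : N q < 1) (q0 : q != 0).

Local Notation Q := (q ^+ 8).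

Let Q1 : N Q < 1. Proof. exact: NX_lt1. Qed.

Definition triple_term (y : C) (w : nat -> nat -> C) (t : nat * nat * nat) : C :=
  let: (i, j, k) := t in
  let n : int := j%:Z + k%:Z in
  y ^+ i * q ^ (4 * (i%:Z * i%:Z) - 4 * (i%:Z * n) + 2 * (n * n)) * w j k
    / (qpoch Q Q i * qpoch Q Q j * qpoch Q Q k).

Definition pair_term (y : C) (w : nat -> nat -> C) (p : nat * nat) : C :=
  let: (j, k) := p in
  let n : int := j%:Z + k%:Z in
  q ^ (2 * (n * n)) * qpoch_inf (- (y * q ^ (4 - 4 * n))) Q * w j k
    / (qpoch Q Q j * qpoch Q Q k).

Lemma exp_absorb (X : R) : exists t : nat, X * N q ^+ t <= 1.
Proof.
pose L : R := `|X| + 1.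
have L0 : 0 < L by rewrite ltr_pwDr.
have /seq_cvgP h := seq_cvg_expr q1.
have [|t tP] := h L^-1; first by rewrite invr_gt0.
exists t; have := tP t (leqnn t); rewrite subr0 NX => {}h.
have {}h : L * N q ^+ t <= 1 by rewrite mulrC -ler_pdivlMr // mul1r ltW.
apply: le_trans h; rewrite ler_wpM2r ?exprn_ge0 ?N_ge0 //.
by rewrite (le_trans (ler_norm _)) // /L lerDl.
Qed.

Lemma dominated_geometric3 (r : R) : 0 <= r < 1 ->
  dominated (fun t : nat * nat * nat => r ^+ t.1.1 * r ^+ t.1.2 * r ^+ t.2).
Proof.
move=> r01; have r0 n : 0 <= r ^+ n by rewrite exprn_ge0 //; case/andP: r01.
have g := dominated_geometric r01.
have g2 := dominated_pair r0 r0 g g.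
by have := dominated_pair (fun p : nat * nat => mulr_ge0 (r0 p.1) (r0 p.2)) r0 g2 g.
Qed.

Lemma N_exprz_le (a b : int) : a <= b -> N q ^ b <= N q ^ a.
Proof.
move=> ab; have Nq0 : 0 < N q by rewrite N_gt0.
have -> : b = a + `|b - a|%N%:Z by lia.
rewrite expfzDr ?gt_eqF // ler_piMr ?exprz_ge0 ?N_ge0 // -exprnP.
by rewrite exprn_ile1 ?N_ge0 // ltW.
Qed.

(* The exponent (2 i - n)^2 + n^2 is positive definite, so any geometric growth
   of y^i and w j k is absorbed. *)
Lemma triple_term_bound (y : C) (w : nat -> nat -> C) (c L : R) : 0 <= L ->
  (forall j k, N (w j k) <= c * L ^+ (j + k)) ->
  exists2 b, dominated b & forall t, N (triple_term y w t) <= b t.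
Proof.
move=> L0 wc; have r0 := N_ge0 q; have rgt0 : 0 < N q by rewrite N_gt0.
have c0 : 0 <= c by have := le_trans (N_ge0 _) (wc 0 0)%N; rewrite expr0 mulr1.
have [cQ cQ0 cQP] := qpochqq_ge Q1.
have [s sP] := exp_absorb (N y); have [u uP] := exp_absorb L.
pose t := (s + u)%N.
(* Put T = s + u + 1. Completing squares around 2 i - n = T and n = 2 T, where n = j + k, costs T^2
   + 4 T^2; this is the origin of the 5. *)
pose K : R := (cQ * cQ * cQ)^-1 * (c * (N q ^ (5 * (t.+1%:Z * t.+1%:Z)))^-1).
exists (fun x => K * (N q ^+ x.1.1 * N q ^+ x.1.2 * N q ^+ x.2)).
  apply: dominatedZ; last by apply: dominated_geometric3; rewrite r0.
  by rewrite /K !mulr_ge0 ?invr_ge0 ?exprz_ge0 ?mulr_ge0 // ltW.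
have absorb (X : R) (e n : nat) : 0 <= X -> X * N q ^+ e <= 1 ->
    X ^+ n <= N q ^ (- (e%:Z * n%:Z)).
  move=> X0 Xe; rewrite -invr_expz -exprz_exp -[leRHS]div1r.
  by rewrite ler_pdivlMr ?exprz_gt0 // -!exprnP -exprMn exprn_ile1 // mulr_ge0 ?exprn_ge0.
move=> [[i j] k] /=; rewrite /K -[leRHS]mulrA; apply: N_div_le.
- by rewrite !mulr_gt0.
- rewrite !NM NX NXz; set E := (4 * _ - _ + _).
  have h1 := absorb _ _ i (N_ge0 y) sP; have h2 := absorb _ _ (j + k)%N L0 uP.
  apply: (@le_trans _ _ (N q ^ (- (s%:Z * i%:Z)) * N q ^ E * (c * N q ^ (- (u%:Z * (j + k)%N%:Z))))).
    rewrite ler_pM ?mulr_ge0 ?exprn_ge0 ?exprz_ge0 ?N_ge0 //.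
      by rewrite ler_wpM2r ?exprz_ge0.
    by apply: le_trans (wc j k) _; rewrite ler_wpM2l.
  rewrite mulrCA -mulrA ler_wpM2l // invr_expz.
  have Nq0 : N q != 0 by rewrite gt_eqF.
  rewrite !exprnP -!(expfzDr _ _ Nq0); apply: N_exprz_le.
  have eT : t.+1%:Z = s%:Z + u%:Z + 1 by rewrite /t -addn1 !PoszD.
  rewrite /E -subr_ge0 eT PoszD.
  have -> : - (s%:Z * i%:Z) + (4 * (i%:Z * i%:Z) - 4 * (i%:Z * (j%:Z + k%:Z)) +
        2 * ((j%:Z + k%:Z) * (j%:Z + k%:Z))) - u%:Z * (j%:Z + k%:Z) -
      (- (5 * ((s%:Z + u%:Z + 1) * (s%:Z + u%:Z + 1))) + (i%:Z + j%:Z + k%:Z)) =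
      (2 * i%:Z - (j%:Z + k%:Z) - (s%:Z + u%:Z + 1)) ^+ 2 +
      (j%:Z + k%:Z - 2 * (s%:Z + u%:Z + 1)) ^+ 2 +
      (3 * (s%:Z + u%:Z + 1) + u%:Z) * i%:Z +
      (s%:Z + u%:Z + 1 + s%:Z) * (j%:Z + k%:Z) by ring.
  by rewrite !addr_ge0 ?sqr_ge0 // mulr_ge0.
by rewrite !NM !ler_pM ?mulr_ge0 ?cQP // ltW.
Qed.

Lemma prod_oct (x : C) s :
  \prod_(k < s) (Q ^+ k * x) = q ^ (4 * (s%:Z * s%:Z) - 4 * s%:Z) * x ^+ s.
Proof.
elim: s => [|s IH]; first by rewrite big_ord0 !mulr0 subr0 expr0z mulr1.
rewrite big_ord_recr /= IH -exprM exprSr.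
have -> : q ^ (4 * (s.+1%:Z * s.+1%:Z) - 4 * s.+1%:Z)
    = q ^ (4 * (s%:Z * s%:Z) - 4 * s%:Z) * q ^+ (8 * s).
  by rewrite exprnP -(expfzDr _ _ q0); congr (_ ^ _); lia.
ring.
Qed.

Lemma pair_term_row (y : C) (w : nat -> nat -> C) (j k : nat) :
  has_sum (fun i => triple_term y w (i, j, k)) (pair_term y w (j, k)).
Proof.
rewrite /triple_term /pair_term; set n : int := j%:Z + k%:Z.
have := has_sumZ (c := q ^ (2 * (n * n)) * w j k / (qpoch Q Q j * qpoch Q Q k))
  (@euler_sum _ _ Q1 (- (y * q ^ (4 - 4 * n)))).
rewrite [X in has_sum _ X](_ : _ = q ^ (2 * (n * n)) *
  qpoch_inf (- (y * q ^ (4 - 4 * n))) Q * w j k / (qpoch Q Q j * qpoch Q Q k));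
  last by ring.
move=> /eq_has_sum; apply => i; rewrite /euler_term opprK prod_oct.
have -> : q ^ (4 * (i%:Z * i%:Z) - 4 * (i%:Z * n) + 2 * (n * n)) =
    q ^ (2 * (n * n)) * (q ^ (4 * (i%:Z * i%:Z) - 4 * i%:Z) * (q ^ (4 - 4 * n)) ^+ i).
  rewrite exprnP exprz_exp -!(expfzDr _ _ q0); congr (_ ^ _); ring.
rewrite exprMn.
by field; rewrite !(qpochqq_neq0 Q1).
Qed.

(** On this diagonal j + k is m = n + 2 s. The product at 4 - 4 m consists of [s] initial factors
    and a tail independent of [s]; the initial factors, read backwards and combined with q^(2 m^2),
    are the numerator of [durfee_term]. *)
Lemma pair_term_diag (y : C) (w : int -> C) (n : nat) : y != 0 ->
  has_sum (fun s => pair_term y (fun j k => w (j%:Z - k%:Z)) (s + n, s)%N)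
    (w n * q ^ (2 * (n%:Z * n%:Z)) * qpoch_inf (- (y * q ^ (4 - 4 * n%:Z))) Q
       * qpoch_inf (- (y * q ^ (4 + 4 * n%:Z))) Q / qpoch_inf Q Q).
Proof.
move=> y0; set z := - (y * q ^ (4 + 4 * n%:Z)).
set c := w n * q ^ (2 * (n%:Z * n%:Z)) * qpoch_inf (- (y * q ^ (4 - 4 * n%:Z))) Q.
rewrite -mulrA.
apply: (eq_has_sum (has_sumZ (c := c) (@durfee_sum _ _ Q1 z n))) => s.
rewrite /pair_term /durfee_term.
set m : int := _ + _.
have -> : (s + n)%N%:Z - s%:Z = n by rewrite PoszD addrC addKr.
have hm : m = n%:Z + 2 * s%:Z by rewrite /m PoszD; ring.
have -> : qpoch_inf (- (y * q ^ (4 - 4 * m))) Q = qpoch (- (y * q ^ (4 - 4 * m))) Q s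
    * qpoch_inf (- (y * q ^ (4 - 4 * n%:Z))) Q.
  rewrite (@qpoch_inf_split _ _ Q1 (- (y * q ^ (4 - 4 * m))) s).
  have -> : - (y * q ^ (4 - 4 * m)) * Q ^+ s = - (y * q ^ (4 - 4 * n%:Z)); last by [].
  rewrite mulNr -mulrA -exprM exprnP -(expfzDr _ _ q0) hm PoszM.
  by congr (- (y * _ ^ _)); ring.
have H : q ^ (2 * (m * m)) * qpoch (- (y * q ^ (4 - 4 * m))) Q s =
    q ^ (2 * (n%:Z * n%:Z)) * \prod_(k < s) (Q ^+ k * (Q ^+ (n + k).+1 - z)).
  rewrite hm {hm m}; elim: s => [|s IH].
    by rewrite big_ord0 qpoch0 mulr0 addr0.
  rewrite big_ord_recr /= [RHS]mulrA -IH qpoch_recl.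
  have -> : - (y * q ^ (4 - 4 * (n%:Z + 2 * s.+1%:Z))) * Q =
      - (y * q ^ (4 - 4 * (n%:Z + 2 * s%:Z))).
    rewrite mulNr -mulrA exprnP -(expfzDr _ _ q0) intS.
    by congr (- (y * _ ^ _)); ring.
  set X := qpoch _ _ _.
  set a := q ^ (2 * ((n%:Z + 2 * s.+1%:Z) * _)); set A := q ^ (2 * ((n%:Z + 2 * s%:Z) * _)).
  have e1 : a = A * (Q ^+ s * Q ^+ (n + s).+1).
    rewrite /a /A -exprD -exprM exprnP -(expfzDr _ _ q0) !(PoszM, PoszD, intS).
    by congr (_ ^ _); ring.
  have e2 : a * q ^ (4 - 4 * (n%:Z + 2 * s.+1%:Z)) = A * (Q ^+ s * q ^ (4 + 4 * n%:Z)).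
    rewrite /a /A -exprM exprnP -!(expfzDr _ _ q0) !(PoszM, intS).
    by congr (_ ^ _); ring.
  rewrite /z !opprK.
  transitivity (a * X + y * (a * q ^ (4 - 4 * (n%:Z + 2 * s.+1%:Z))) * X); first by ring.
  by rewrite e2 e1; ring.
rewrite /c (mulrC (qpoch Q Q (s + n))).
transitivity (w n * qpoch_inf (- (y * q ^ (4 - 4 * n%:Z))) Q *
   (q ^ (2 * (m * m)) * qpoch (- (y * q ^ (4 - 4 * m))) Q s)
   / (qpoch Q Q s * qpoch Q Q (s + n))); first by rewrite H; ring.
by ring.
Qed.

Lemma pair_term_sym (y : C) (w : nat -> nat -> C) (j k : nat) :
  pair_term y w (j, k) = pair_term y (fun a b => w b a) (k, j).
Proof. by rewrite /pair_term (addrC j%:Z) (mulrC (qpoch Q Q j)). Qed.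

Lemma triple_sum_rows (y : C) (w : nat -> nat -> C) (c L : R) :
  0 <= L -> (forall j k, N (w j k) <= c * L ^+ (j + k)) ->
  exists s, has_sum (triple_term y w) s /\ has_sum (pair_term y w) s.
Proof.
move=> L0 wc; have [b db bP] := triple_term_bound y L0 wc.
have [s hs] := has_sum_dominated bP db; exists s; split=> //.
apply: (has_sum_fubini (h := fun (p : nat * nat) (i : nat) => (i, p.1, p.2))
  (pi := fun t => (t.1.2, t.2)) (k := fun t => t.1.1) _ _ _ hs).
- by case.
- by [].
- by case=> [[]].
by case=> j k; exact: pair_term_row.
Qed.

Definition diag_sum (y : C) (w : int -> C) (d : int) : C :=
  w d * q ^ (2 * (d * d)) * qpoch_inf (- (y * q ^ (4 - 4 * d))) Q
    * qpoch_inf (- (y * q ^ (4 + 4 * d))) Q / qpoch_inf Q Q.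

Lemma pair_sum_diag (y : C) (w : int -> C) s : y != 0 ->
  has_sum (pair_term y (fun j k => w (j%:Z - k%:Z))) s ->
  has_sum (diag_sum y w) s.
Proof.
move=> y0 hs; apply: (has_sum_diagonals hs) => n; first exact: pair_term_diag.
(* Exchanging j and k turns a negative diagonal into a positive one for the reflected weight. *)
have := @pair_term_diag y (fun d => w (- d)) n y0.
have -> : w (- n%:Z) * q ^ (2 * (n%:Z * n%:Z)) *
    qpoch_inf (- (y * q ^ (4 - 4 * n%:Z))) Q *
    qpoch_inf (- (y * q ^ (4 + 4 * n%:Z))) Q / qpoch_inf Q Q = diag_sum y w (- n%:Z).
  by rewrite /diag_sum !mulrN mulNr mulrN opprK opprK [in RHS]mulrAC; ring.
move/eq_has_sum; apply => t; rewrite pair_term_sym.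
by rewrite /pair_term opprB.
Qed.

Lemma triple_sum (y : C) (w : int -> C) (c L : R) :
  y != 0 -> 1 <= L -> (forall d, N (w d) <= c * L ^+ `|d|) ->
  exists s, [/\ has_sum (triple_term y (fun j k => w (j%:Z - k%:Z))) s,
    has_sum (pair_term y (fun j k => w (j%:Z - k%:Z))) s &
    has_sum (diag_sum y w) s].
Proof.
move=> y0 L1 wc; have L0 : 0 <= L by apply: le_trans L1.
have c0 : 0 <= c by have := le_trans (N_ge0 _) (wc 0); rewrite absz0 expr0 mulr1.
have [|s [h1 h2]] := @triple_sum_rows y (fun j k => w (j%:Z - k%:Z)) c L L0.
  move=> j k; apply: le_trans (wc _) _; rewrite ler_wpM2l // ler_weXn2l //.
  by clear; lia.
by exists s; split=> //; exact: pair_sum_diag.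
Qed.

End TripleSum.

(** * Finite sums over j + k = n *)

Section FiniteSums.
Context {R : realType}.
Local Notation C := (R[i])%C.
Variable q : C.
Hypotheses (q1 : N q < 1) (q0 : q != 0).

Local Notation Q := (q ^+ 8).
Let Q1 : N Q < 1. Proof. exact: NX_lt1. Qed.

(** Half of a q-Pascal rule: the factor 1 - Q^j kills the end term and cancels against (Q; Q)_j.
    Together with the mirror rule it is used after splitting 1 - Q^(j+k) as (1 - Q^k) + Q^k (1 -
    Q^j), or with j and k exchanged. *)
Lemma conv_split_l (F : nat -> nat -> C) n :
  \sum_(j < n.+2) F j (n.+1 - j)%N * (1 - Q ^+ j) / (qpoch Q Q j * qpoch Q Q (n.+1 - j))
  = \sum_(j < n.+1) F j.+1 (n - j)%N / (qpoch Q Q j * qpoch Q Q (n - j)).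
Proof.
rewrite big_ord_recl /= expr0 subrr mulr0 mul0r add0r; apply: eq_bigr => j _.
rewrite /bump /= add1n subSS qpochS -exprS.
field; rewrite !(qpochqq_neq0 Q1) (one_sub_qX_neq0 Q1) //.
Qed.

Lemma conv_split_r (F : nat -> nat -> C) n :
  \sum_(j < n.+2) F j (n.+1 - j)%N * (1 - Q ^+ (n.+1 - j))
     / (qpoch Q Q j * qpoch Q Q (n.+1 - j))
  = \sum_(j < n.+1) F j (n - j).+1 / (qpoch Q Q j * qpoch Q Q (n - j)).
Proof.
rewrite big_ord_recr /= subnn expr0 subrr mulr0 mul0r addr0; apply: eq_bigr => j _.
rewrite subSn -1?ltnS // qpochS -exprS.
field; rewrite !(qpochqq_neq0 Q1) (one_sub_qX_neq0 Q1) //.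
Qed.

Lemma qbinomial (y : C) n :
  \sum_(j < n.+1) q ^ (4 * (j%:Z * j%:Z) - 4 * j%:Z) * y ^+ j
     / (qpoch Q Q j * qpoch Q Q (n - j))
  = qpoch (- y) Q n / qpoch Q Q n.
Proof.
elim: n => [|n IH].
  by rewrite big_ord1 /= !qpoch0 !mulr0 subrr expr0z expr0 !mulr1.
have D : 1 - Q ^+ n.+1 != 0 by exact: one_sub_qX_neq0.
apply: (mulfI D); rewrite !qpochS -exprS.
have -> : (1 - Q ^+ n.+1) * (qpoch (- y) Q n * (1 - - y * Q ^+ n) / (qpoch Q Q n * (1 - Q ^+ n.+1)))
   = (qpoch (- y) Q n / qpoch Q Q n) * (1 + y * Q ^+ n).
  by field; rewrite D qpochqq_neq0.
rewrite -IH mulrDr mulr1.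
pose F (j k : nat) := q ^ (4 * (j%:Z * j%:Z) - 4 * j%:Z) * y ^+ j.
have -> : (\sum_(j < n.+1) q ^ (4 * (j%:Z * j%:Z) - 4 * j%:Z) * y ^+ j
     / (qpoch Q Q j * qpoch Q Q (n - j))) * (y * Q ^+ n) =
     \sum_(j < n.+1) (F j.+1 (n - j)%N * Q ^+ (n - j)%N) / (qpoch Q Q j * qpoch Q Q (n - j)).
  rewrite mulr_suml; apply: eq_bigr => j _; rewrite mulrAC; congr (_ / _).
  rewrite /F (exprS y).
  have jn : (j <= n)%N by rewrite -ltnS.
  have -> : Q ^+ n = Q ^+ j * Q ^+ (n - j) by rewrite -exprD subnKC.
  have -> : q ^ (4 * (j.+1%:Z * j.+1%:Z) - 4 * j.+1%:Z) =
     q ^ (4 * (j%:Z * j%:Z) - 4 * j%:Z) * Q ^+ j.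
    by rewrite -exprM exprnP -(expfzDr _ _ q0) PoszM intS; congr (_ ^ _); ring.
  by ring.
rewrite -(conv_split_r F n) -(conv_split_l (fun j k => F j k * Q ^+ k)).
rewrite mulr_sumr -[RHS]big_split; apply: eq_bigr => j _ /=.
have jn : (j <= n.+1)%N by rewrite -ltnS.
have -> : Q ^+ n.+1 = Q ^+ j * Q ^+ (n.+1 - j) by rewrite -exprD subnKC.
by rewrite /F; ring.
Qed.

Local Notation p := (q ^+ 4).

Lemma qpoch_sq (z : C) (b : C) n : qpoch z b n * qpoch (- z) b n = qpoch (z ^+ 2) (b ^+ 2) n.
Proof.
rewrite /qpoch -big_split /=; apply: eq_bigr => k _.
by rewrite -exprM mulnC exprM; ring.
Qed.

(** In base b = 1/Q the q-binomial coefficients absorb q^(-8 j (n - j)). Up to the reversal j -> n -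
    j this is the classical value (-b^(1/2); b^(1/2))_n of the Rogers-Szego polynomial at b^(1/2),
    divided by (Q; Q)_n = (p; p)_n (-p; p)_n. *)
Lemma rogers_szego n :
  \sum_(j < n.+1) q ^ (- (8 * (j%:Z * (n%:Z - j%:Z))) + 4 * j%:Z)
     / (qpoch Q Q j * qpoch Q Q (n - j))
  = (q ^ (2 * (n%:Z * n%:Z) - 2 * n%:Z) * qpoch p p n)^-1.
Proof.
have p1 : N p < 1 by exact: NX_lt1.
have p0 : p != 0 by rewrite expf_neq0.
(* Only c = 4 is wanted, but a factor Q^j raises c by 8, so the recurrences couple it to c = 12. *)
pose S (c : int) m : C := \sum_(j < m.+1) q ^ (- (8 * (j%:Z * (m%:Z - j%:Z))) + c * j%:Z)
     / (qpoch Q Q j * qpoch Q Q (m - j)).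
have shift m : \sum_(j < m.+2) q ^ (- (8 * (j%:Z * (m.+1%:Z - j%:Z))) + 4 * j%:Z)
     * (1 - Q ^+ j) / (qpoch Q Q j * qpoch Q Q (m.+1 - j))
     = p * Q ^- m * S 12 m.
  pose F (j k : nat) := q ^ (- (8 * (j%:Z * k%:Z)) + 4 * j%:Z).
  transitivity (\sum_(j < m.+2) F j (m.+1 - j)%N
     * (1 - Q ^+ j) / (qpoch Q Q j * qpoch Q Q (m.+1 - j))).
    apply: eq_bigr => j _; have jm : (j <= m.+1)%N by rewrite -ltnS.
    by rewrite /F -subzn.
  rewrite conv_split_l /S mulr_sumr; apply: eq_bigr => j _.
  have jm : (j <= m)%N by rewrite -ltnS.
  rewrite [RHS]mulrA; congr (_ / _).
  rewrite -exprM /F exprnN exprnP -!(expfzDr _ _ q0) -subzn // PoszM intS.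
  by congr (_ ^ _); ring.
have rec1 m : (1 - Q ^+ m.+1) * S 4 m.+1 = p * Q ^- m * S 12 m + S 4 m.
  pose F (j k : nat) := q ^ (- (8 * (j%:Z * k%:Z)) + 4 * j%:Z).
  have -> : S 4 m = \sum_(j < m.+1) (F j (m - j).+1 * Q ^+ j) / (qpoch Q Q j * qpoch Q Q (m - j)).
    apply: eq_bigr => j _; congr (_ / _); have jm : (j <= m)%N by rewrite -ltnS.
    rewrite /F -exprM exprnP -!(expfzDr _ _ q0) intS -subzn // PoszM.
    by congr (_ ^ _); ring.
  rewrite -shift -(conv_split_r (fun j k => F j k * Q ^+ j) m) mulr_sumr -[RHS]big_split.
  apply: eq_bigr => j _ /=; have jm : (j <= m.+1)%N by rewrite -ltnS.
  have -> : Q ^+ m.+1 = Q ^+ j * Q ^+ (m.+1 - j) by rewrite -exprD subnKC.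
  by rewrite /F -subzn //; ring.
have rec2 m : S 4 m.+1 - S 12 m.+1 = p * Q ^- m * S 12 m.
  rewrite -shift -sumrB; apply: eq_bigr => j _.
  rewrite -mulrBl; congr (_ / _); rewrite [RHS]mulrBr [in RHS]mulr1; congr (_ - _).
  by rewrite -exprM exprnP -(expfzDr _ _ q0) PoszM; congr (_ ^ _); ring.
have Qp m : Q ^+ m = p ^+ m ^+ 2 by rewrite -!exprM; congr (_ ^+ _); lia.
(* The value of [S 12] is carried along: [rec1] then determines [S 4] at the next index, and [rec2]
   determines [S 12] there. *)
suff H m : p * S 12 m = S 4 m * (p ^+ m + p * p ^+ m ^+ 2 - p ^+ m ^+ 2) /\
    S 4 m = (q ^ (2 * (m%:Z * m%:Z) - 2 * m%:Z) * qpoch p p m)^-1.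
  by case: (H n).
elim: m => [|m [IHb IHa]].
  rewrite /S !big_ord1 /= !qpoch0 !(mul0r, mulr0, subrr, oppr0, addr0) !expr0z.
  by split; field.
have P0 := expf_neq0 m p0; have D := one_sub_qX_neq0 p1 m.
have D2 := one_sub_qX_neq0 Q1 m.
have h1 := rec1 m; have h2 := rec2 m.
move: h1 h2 D2; rewrite mulrAC IHb !Qp (exprS p m) => h1 h2 D2.
rewrite (exprS p m) in D.
have D3 : 1 + p * p ^+ m != 0.
  apply: contraNneq D2 => e.
  have -> : 1 - (p * p ^+ m) ^+ 2 = (1 + p * p ^+ m) * (1 - p * p ^+ m) by ring.
  by rewrite e mul0r.
have ha : S 4 m = S 4 m.+1 * p ^+ m * (1 - p * p ^+ m).
  apply: (mulIf D3).
  move: h1 {h2 IHa IHb D D2 D3}; move: p (p ^+ m) (S 4 m) (S 4 m.+1) p0 P0 => pp P a a' pp0 P0' h1.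
  have -> : a' * P * (1 - pp * P) * (1 + pp * P) = P * ((1 - (pp * P) ^+ 2) * a') by ring.
  by rewrite h1; field.
split.
  have -> : S 12 m.+1 = S 4 m.+1 - (S 4 m.+1 - S 12 m.+1) by ring.
  rewrite h2 ha; move: (p ^+ m) P0 => P P0; field.
  exact: P0.
apply: (mulIf (mulf_neq0 P0 D)).
have -> : S 4 m.+1 * (p ^+ m * (1 - p * p ^+ m)) = S 4 m by rewrite ha; ring.
rewrite IHa qpochS.
have -> : q ^ (2 * (m.+1%:Z * m.+1%:Z) - 2 * m.+1%:Z) =
    q ^ (2 * (m%:Z * m%:Z) - 2 * m%:Z) * p ^+ m.
  by rewrite -exprM exprnP -(expfzDr _ _ q0) PoszM intS; congr (_ ^ _); ring.
have Z := expfz_neq0 (2 * (m%:Z * m%:Z) - 2 * m%:Z) q0.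
have G := qpochqq_neq0 p1 m.
move: (q ^ _) Z G => z Z G; move: (qpoch p p m) G => g G.
move: p (p ^+ m) P0 D => pp P P0' D'.
by field; rewrite Z P0' G D'.
Qed.

End FiniteSums.

(** * Infinite products *)

Section Products.
Context {R : realType}.
Local Notation C := (R[i])%C.
Implicit Types (z b q : C).

Lemma qpoch_inf_split2 z b : N b < 1 ->
  qpoch_inf z b = qpoch_inf z (b ^+ 2) * qpoch_inf (z * b) (b ^+ 2).
Proof.
move=> b1; have b2 : N (b ^+ 2) < 1 by exact: NX_lt1.
have h := seq_cvgM (@qpoch_cvg _ _ b2 z) (@qpoch_cvg _ _ b2 (z * b)).
apply: seq_cvg_uniq h.
apply: (@eq_seq_cvg _ (fun n => qpoch z b n.*2)).
  have /seq_cvgP c := @qpoch_cvg _ _ b1 z; apply/seq_cvgP => e /c[n0 n0P].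
  by exists n0 => n nn0; apply: n0P; rewrite -addnn (leq_trans nn0) ?leq_addr.
elim=> [|n IH]; first by rewrite !qpoch0 mulr1.
rewrite doubleS !qpochS IH -!exprM -mul2n.
by rewrite (exprS b (2 * n)); ring.
Qed.

Lemma qpoch_inf_sq z b : N b < 1 ->
  qpoch_inf z b * qpoch_inf (- z) b = qpoch_inf (z ^+ 2) (b ^+ 2).
Proof.
move=> b1; have b2 : N (b ^+ 2) < 1 by exact: NX_lt1.
have h := seq_cvgM (@qpoch_cvg _ _ b1 z) (@qpoch_cvg _ _ b1 (- z)).
apply: (seq_cvg_uniq h).
by apply: (eq_seq_cvg (@qpoch_cvg _ _ b2 (z ^+ 2))) => n; rewrite qpoch_sq.
Qed.

Lemma qpoch_infN_self b : N b < 1 ->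
  qpoch_inf b b * qpoch_inf (- b) b = qpoch_inf (b ^+ 2) (b ^+ 2).
Proof. exact: qpoch_inf_sq. Qed.

(** The classical (-b; b^2)_oo = J_2^2 / (J_1 J_4), in base b and with denominators cleared. The key
    is that (b; b^2)_oo (-b; b^2)_oo = (b^2; b^4)_oo. *)
Lemma qpoch_infN_odd b : N b < 1 ->
  qpoch_inf (- b) (b ^+ 2) * (qpoch_inf b b * qpoch_inf (b ^+ 4) (b ^+ 4))
  = qpoch_inf (b ^+ 2) (b ^+ 2) ^+ 2.
Proof.
move=> b1; have b2 : N (b ^+ 2) < 1 by exact: NX_lt1.
have h1 := qpoch_inf_split2 b b1; have h2 := qpoch_inf_sq b b2.
have h3 := qpoch_inf_split2 (b ^+ 2) b2.
have e : (b ^+ 2) ^+ 2 = b ^+ 4 by rewrite -exprM.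
rewrite -expr2 in h1; rewrite -expr2 e in h3; rewrite e in h2.
move: h1 h2 h3; set W := qpoch_inf (b ^+ 4) (b ^+ 4); set Y := qpoch_inf (b ^+ 2) (b ^+ 2).
set X' := qpoch_inf (- b) _; set X := qpoch_inf b (b ^+ 2); move: X X' Y W => X X' Y W.
move=> -> h2 h3; transitivity (Y * ((X * X') * W)); first by ring.
by rewrite h2 -h3 expr2.
Qed.

Lemma qpoch_infN1 b : N b < 1 -> qpoch_inf (- 1) b = 2 * qpoch_inf (- b) b.
Proof. by move=> b1; rewrite (qpoch_inf_recl b1) mulN1r opprK. Qed.

End Products.

(** * Parity splitting and reindexing of sums over the integers *)

Section IntegerSums.
Context {R : realType}.
Local Notation C := (R[i])%C.

Lemma int_parity (d : int) : exists r : int, d = 2 * r \/ d = 2 * r + 1.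
Proof.
exists (divz d 2); have := divz_eq d 2; have := modz_ge0 d (isT : (2 : int) != 0).
by have := ltz_pmod d (isT : 0 < (2 : int)); lia.
Qed.

Lemma has_sum_parity (f : int -> C) s0 s1 :
  has_sum (fun r => f (2 * r)) s0 -> has_sum (fun r => f (2 * r + 1)) s1 ->
  has_sum f (s0 + s1).
Proof.
move=> h0 h1.
have k0 : cancel (fun r : int => 2 * r) (fun d => divz d 2).
  by move=> r; rewrite mulrC mulzK.
have k1 : cancel (fun r : int => 2 * r + 1) (fun d => divz d 2).
  by move=> r; rewrite mulrC divzMDl // addr0.
pose f0 d : C := if 2 * divz d 2 == d then f d else 0.
pose f1 d : C := if 2 * divz d 2 == d then 0 else f d.
have z0 d : 2 * divz d 2 != d -> f0 d = 0 by rewrite /f0 => /negPf ->.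
have z1 d : 2 * divz d 2 + 1 != d -> f1 d = 0.
  rewrite /f1; have [r [->|->]] := int_parity d; first by rewrite k0 eqxx.
  by rewrite k1 eqxx.
have s0' : has_sum f0 s0.
  by apply: (proj2 (has_sum_can s0 k0 z0)); apply: (eq_has_sum h0) => r; rewrite /f0 k0 eqxx.
have s1' : has_sum f1 s1.
  apply: (proj2 (has_sum_can s1 k1 z1)); apply: (eq_has_sum h1) => r.
  by rewrite /f1 k1 lt_eqF // ltrDl.
apply: (eq_has_sum (has_sumD s0' s1')) => d; rewrite /f0 /f1.
by case: ifP; rewrite ?addr0 ?add0r.
Qed.

Lemma has_sum_translate (f : int -> C) (c : int) s :
  has_sum f s -> has_sum (fun r => f (r + c)) s.
Proof.
move=> fs; have K : cancel (fun r => r + c) (fun r => r - c) by move=> r; rewrite addrK.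
by apply: (proj1 (has_sum_can s K _) fs) => r; rewrite subrK eqxx.
Qed.

Lemma has_sum_reflect (f : int -> C) (c : int) s :
  has_sum f s -> has_sum (fun r => f (c - r)) s.
Proof.
have K : cancel (fun r => c - r) (fun r => c - r).
  by move=> r; rewrite opprB addrC subrK.
by move=> fs; apply: (proj1 (has_sum_can s K _) fs) => r; rewrite K eqxx.
Qed.

End IntegerSums.

(** * Quasi-periodicity of the theta products left by the diagonal summation *)

Section Theta.
Context {R : realType}.
Local Notation C := (R[i])%C.
Variable q : C.
Hypotheses (q1 : N q < 1) (q0 : q != 0).

Local Notation Q := (q ^+ 8).
Local Notation A := (qpoch_inf (- q ^+ 4) Q).
Local Notation B := (qpoch_inf (- Q) Q).
Local Notation E := (qpoch_inf Q Q).
Let Q1 : N Q < 1. Proof. exact: NX_lt1. Qed.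
Let p1 : N (q ^+ 4) < 1. Proof. exact: NX_lt1. Qed.

Definition shifted (n : int) : C := qpoch_inf (- q ^ (4 - 4 * n)) Q.

Lemma shifted_rec n : shifted (n + 1) = (1 + q ^ (- (4 * n))) * shifted (n - 1).
Proof.
rewrite /shifted (qpoch_inf_recl Q1) opprK mulNr exprnP -(expfzDr _ _ q0).
by congr ((1 + _ ^ _) * qpoch_inf (- _ ^ _) _); ring.
Qed.

(** By the triple product, [kappa d * E] is the sum of q^((2 m + d)^2) over all integers m; the
    prefactor q^(d^2) removes the quasi-periodicity factor, leaving only the parity of d. *)
Definition kappa (d : int) : C := q ^ (d * d) * shifted d * shifted (- d).

Lemma kappaN d : kappa (- d) = kappa d.
Proof. by rewrite /kappa mulrNN opprK mulrAC. Qed.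

(** From d - 1 to d + 1 one product gains the factor 1 + q^(-4 d) and the other loses 1 + q^(4 d);
    their ratio q^(-4 d) is compensated by (d + 1)^2 - (d - 1)^2 = 4 d. *)
Lemma kappaS d : kappa (d + 1) = kappa (d - 1).
Proof.
rewrite /kappa shifted_rec.
have -> : - (d - 1) = - d + 1 by ring.
rewrite shifted_rec mulrN opprK.
have -> : - (d + 1) = - d - 1 by ring.
have -> : q ^ ((d + 1) * (d + 1)) = q ^ ((d - 1) * (d - 1)) * q ^ (4 * d).
  by rewrite -(expfzDr _ _ q0); congr (_ ^ _); ring.
have h : q ^ (4 * d) * q ^ (- (4 * d)) = 1.
  by rewrite -(expfzDr _ _ q0) subrr expr0z.
transitivity (q ^ ((d - 1) * (d - 1)) * (q ^ (4 * d) + q ^ (4 * d) * q ^ (- (4 * d)))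
  * shifted (d - 1) * shifted (- d - 1)); first by ring.
by rewrite h; ring.
Qed.

Lemma kappa_even r : kappa (2 * r) = A ^+ 2.
Proof.
have k0 : kappa 0 = A ^+ 2.
  by rewrite /kappa /shifted oppr0 !mulr0 subr0 expr0z mul1r exprnP expr2.
have kS s : kappa (2 * (s + 1)) = kappa (2 * s).
  have -> : 2 * (s + 1) = 2 * s + 1 + 1 by ring.
  by rewrite kappaS addrK.
elim/int_rec: r => [|n IH|n IH]; first by rewrite mulr0.
- by rewrite intS (addrC 1) kS.
- by rewrite -IH -[LHS]kS intS opprD addrAC addNr add0r.
Qed.

Lemma kappa_odd r : kappa (2 * r + 1) = 2 * q * B ^+ 2.
Proof.
have k0 : kappa 1 = 2 * q * B ^+ 2.
  rewrite /kappa /shifted !mulr1 mulrN1 opprK subrr expr0z expr1z.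
  by rewrite (qpoch_infN1 Q1) -exprnP expr2; ring.
have kS s : kappa (2 * (s + 1) + 1) = kappa (2 * s + 1).
  have -> : 2 * (s + 1) + 1 = (2 * s + 2) + 1 by ring.
  by rewrite kappaS; congr kappa; ring.
elim/int_rec: r => [|n IH|n IH]; first by rewrite mulr0 add0r.
- by rewrite intS (addrC 1) kS.
- by rewrite -IH -[LHS]kS intS opprD addrAC addNr add0r.
Qed.

(** Two consecutive integers have opposite parities, so both values of [kappa] always occur. This is
    why the theta series in q^3 need no parity split. *)
Lemma kappa_mul d : kappa d * kappa (d + 1) = 2 * q * A ^+ 2 * B ^+ 2.
Proof.
have [r [->|->]] := int_parity d; first by rewrite kappa_even kappa_odd; ring.
have -> : 2 * r + 1 + 1 = 2 * (r + 1) by ring.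
by rewrite kappa_even kappa_odd; ring.
Qed.

Lemma kappa_double d n : kappa (d + 2 * n) = kappa d.
Proof.
have [r [->|->]] := int_parity d; first by rewrite -mulrDr !kappa_even.
by rewrite addrAC -mulrDr !kappa_odd.
Qed.

Lemma qpoch_inf_AB : A * B = qpoch_inf (- q ^+ 4) (q ^+ 4).
Proof.
by rewrite (qpoch_inf_split2 _ p1) mulNr -!exprM -exprD.
Qed.

Lemma qpoch_inf_E_AB : E = qpoch_inf (q ^+ 4) (q ^+ 4) * (A * B).
Proof. by rewrite qpoch_inf_AB (qpoch_infN_self p1) -exprM. Qed.

Lemma qpoch_inf_A_E : A * (qpoch_inf (q ^+ 4) (q ^+ 4) * qpoch_inf (q ^+ 16) (q ^+ 16)) = E ^+ 2.
Proof. by have := qpoch_infN_odd p1; rewrite -!exprM. Qed.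

Lemma qpoch_inf_B_E : E * B = qpoch_inf (q ^+ 16) (q ^+ 16).
Proof. by rewrite (qpoch_infN_self Q1) -exprM. Qed.

Lemma E_neq0 : E != 0. Proof. exact: qpochqq_inf_neq0. Qed.

Lemma A_neq0 : A != 0.
Proof.
have : E ^+ 2 != 0 by rewrite expf_neq0 // E_neq0.
by rewrite -qpoch_inf_A_E mulf_eq0 negb_or => /andP[].
Qed.

Lemma B_neq0 : B != 0.
Proof.
have : qpoch_inf (q ^+ 16) (q ^+ 16) != 0.
  by apply: qpochqq_inf_neq0; exact: NX_lt1.
by rewrite -qpoch_inf_B_E mulf_eq0 negb_or => /andP[].
Qed.

Lemma kappa_neq0 d : kappa d != 0.
Proof.
have [r [->|->]] := int_parity d; first by rewrite kappa_even expf_neq0 ?A_neq0.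
by rewrite kappa_odd !mulf_neq0 ?expf_neq0 ?B_neq0 // pnatr_eq0.
Qed.

Lemma shifted_neq0 d : shifted d != 0.
Proof.
by have := kappa_neq0 d; rewrite /kappa !mulf_eq0 !negb_or => /andP[/andP[]].
Qed.

Lemma shifted_mul d : shifted d * shifted (- d) = q ^ (- (d * d)) * kappa d.
Proof.
by rewrite /kappa !mulrA -(expfzDr _ _ q0) addNr expr0z mul1r.
Qed.

End Theta.

(** * Opposite linear exponents *)

Section Evaluations.
Context {R : realType}.
Local Notation C := (R[i])%C.
Variable q : C.
Hypotheses (q1 : N q < 1) (q0 : q != 0).

Local Notation Q := (q ^+ 8).
Local Notation A := (qpoch_inf (- q ^+ 4) Q).
Local Notation B := (qpoch_inf (- Q) Q).
Local Notation E := (qpoch_inf Q Q).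
Local Notation kappa := (kappa q).
Local Notation shifted := (shifted q).
Let Q1 : N Q < 1. Proof. exact: NX_lt1. Qed.

Definition theta (m : nat) (z : C) : C :=
  qpoch_inf (- (q ^+ m * z)) (q ^+ (2 * m)) * qpoch_inf (- (q ^+ m / z)) (q ^+ (2 * m))
    * qpoch_inf (q ^+ (2 * m)) (q ^+ (2 * m)).

Lemma theta_sum m (z : C) : z != 0 ->
  has_sum (fun d : int => q ^ (m.+1%:Z * (d * d)) * z ^ d) (theta m.+1 z).
Proof.
move=> z0; have p0 : q ^+ m.+1 != 0 by rewrite expf_neq0.
have := jacobi_triple_product (NX_lt1 m q1) p0 z0.
rewrite -exprM mulnC => /eq_has_sum; apply => d.
by rewrite exprnP exprz_exp.
Qed.

Lemma N_exprz_le1 (a : int) : 0 <= a -> N (q ^ a) <= 1.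
Proof. by move=> a0; rewrite NXz -(expr0z (N q)) N_exprz_le. Qed.

Lemma exprz_growth (x : C) : x != 0 ->
  exists2 L : R, 1 <= L & forall d : int, N (x ^ d) <= L ^+ `|d|.
Proof.
move=> x0; have i0 : 0 <= (N x)^-1 by rewrite invr_ge0 N_ge0.
have n0 := N_ge0 x.
exists (1 + N x + (N x)^-1); first lra.
move=> d; rewrite NXz; case: d => n /=.
  by rewrite -exprnP lerXn2r ?nnegrE //; lra.
rewrite NegzE -exprz_inv -exprnP lerXn2r ?nnegrE //; lra.
Qed.

Definition gauss_weight (x : C) (d : int) : C := q ^ (d * d) * x ^ d.

Lemma gauss_triple_sum (y x : C) : y != 0 -> x != 0 -> exists s,
  has_sum (triple_term q y (fun j k => gauss_weight x (j%:Z - k%:Z))) s /\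
  has_sum (diag_sum q y (gauss_weight x)) s.
Proof.
move=> y0 x0; have [L L1 LP] := exprz_growth x0.
have [|s [h1 _ h2]] := @triple_sum _ _ q1 q0 y (gauss_weight x) 1 L y0 L1.
  move=> d; rewrite mul1r NM -[leRHS]mul1r ler_pM ?N_ge0 ?N_exprz_le1 //.
  by rewrite -expr2 sqr_ge0.
by exists s.
Qed.

(** A power y = q^(4 e) merely displaces the arguments of the two products by e; for e = 1 or e = -1
    a single use of [shifted_rec] makes them opposite again. *)
Lemma diag_sum_shifted (w : int -> C) (e d : int) :
  diag_sum q (q ^ (4 * e)) w d
  = w d * (q ^ (2 * (d * d)) * (shifted (d - e) * shifted (- d - e))) / E.
Proof.
have h (n : int) : - (q ^ (4 * e) * q ^ (4 - 4 * n)) = - q ^ (4 - 4 * (n - e)).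
  by rewrite -(expfzDr _ _ q0); congr (- _ ^ _); ring.
have hN := h (- d); rewrite mulrN opprK in hN.
by rewrite /diag_sum h hN !mulrA.
Qed.

Lemma exprz_shifted_mul a d :
  q ^ a * (shifted d * shifted (- d)) = q ^ (a - d * d) * kappa d.
Proof. by rewrite (shifted_mul q0) mulrA -(expfzDr _ _ q0). Qed.

Lemma diag_sum_a0 (w : int -> C) d :
  diag_sum q 1 w d = w d * (q ^ (d * d) * kappa d) / E.
Proof.
have := diag_sum_shifted w 0 d; rewrite mulr0 expr0z => ->.
rewrite !subr0 exprz_shifted_mul; congr (_ * (_ ^ _ * _) / _); ring.
Qed.

Lemma diag_sum_a4 (w : int -> C) d :
  (1 + q ^ (4 * d)) * diag_sum q (q ^ 4) w d
  = w d * (q ^ (d * d + 2 * d - 1) * kappa (d - 1)) / E.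
Proof.
have := diag_sum_shifted w 1 d; rewrite mulr1 => ->.
have := shifted_rec q1 q0 (- d); rewrite mulrN opprK => h.
have := exprz_shifted_mul (2 * (d * d)) (d - 1); rewrite opprB (addrC 1) h => h2.
have -> : q ^ (d * d + 2 * d - 1) * kappa (d - 1) =
    q ^ (2 * (d * d) - (d - 1) * (d - 1)) * kappa (d - 1).
  by congr (_ ^ _ * _); ring.
rewrite -h2; move: (q ^ (2 * (d * d))) (shifted _) (shifted _) => u v t.
by rewrite mulrA; congr (_ / _); ring.
Qed.

Lemma diag_sum_aN4 (w : int -> C) d :
  diag_sum q (q ^ (- 4)) w d
  = w d * (1 + q ^ (- (4 * d))) * (q ^ (d * d + 2 * d - 1) * kappa (d - 1)) / E.
Proof.
have := diag_sum_shifted w (- 1) d; rewrite mulrN1 !opprK => ->.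
rewrite (shifted_rec q1 q0).
have := exprz_shifted_mul (2 * (d * d)) (d - 1); rewrite opprB (addrC 1) => h2.
have -> : q ^ (d * d + 2 * d - 1) * kappa (d - 1) =
    q ^ (2 * (d * d) - (d - 1) * (d - 1)) * kappa (d - 1).
  by congr (_ ^ _ * _); ring.
rewrite -h2; move: (q ^ (2 * (d * d))) (shifted _) (shifted _) => u v t.
by congr (_ / _); ring.
Qed.

Lemma triple_sum_nu (x : C) : x != 0 ->
  has_sum (triple_term q 1 (fun j k => gauss_weight x (j%:Z - k%:Z)))
    (A ^+ 2 / E * theta 8 (x ^+ 2) + 2 * q ^+ 3 * x * (B ^+ 2 / E) * theta 8 (q ^+ 8 * x ^+ 2)).
Proof.
move=> x0; have [s [h1 h2]] := gauss_triple_sum (oner_neq0 _) x0.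
suff -> : A ^+ 2 / E * theta 8 (x ^+ 2) +
    2 * q ^+ 3 * x * (B ^+ 2 / E) * theta 8 (q ^+ 8 * x ^+ 2) = s by [].
apply: has_sum_uniq h2; apply: has_sum_parity.
  have := has_sumZ (c := A ^+ 2 / E) (@theta_sum 7 _ (expf_neq0 2 x0)).
  move=> /eq_has_sum; apply => r; rewrite diag_sum_a0 (kappa_even q1 q0) /gauss_weight.
  have -> : x ^ (2 * r) = x ^+ 2 ^ r by rewrite exprnP exprz_exp.
  have <- : q ^ (2 * r * (2 * r)) * q ^ (2 * r * (2 * r)) = q ^ (8%:Z * (r * r)).
    by rewrite -(expfzDr _ _ q0); congr (_ ^ _); ring.
  by ring.
have z0 : q ^+ 8 * x ^+ 2 != 0 by rewrite mulf_neq0 ?expf_neq0.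
have := has_sumZ (c := 2 * q ^+ 3 * x * (B ^+ 2 / E)) (@theta_sum 7 _ z0).
move=> /eq_has_sum; apply => r; rewrite diag_sum_a0 (kappa_odd q1 q0) /gauss_weight.
have -> : x ^ (2 * r + 1) = x * x ^+ 2 ^ r.
  by rewrite (expfzDr _ _ x0) expr1z exprnP exprz_exp mulrC.
have -> : (q ^+ 8 * x ^+ 2) ^ r = q ^+ 8 ^ r * x ^+ 2 ^ r.
  by rewrite exprzMl // unitfE ?expf_neq0.
have h : q ^+ 3 * (q ^ (8%:Z * (r * r)) * q ^+ 8 ^ r)
    = q ^ ((2 * r + 1) * (2 * r + 1)) * q ^ ((2 * r + 1) * (2 * r + 1)) * q.
  rewrite -[X in _ = _ * X]expr1z !exprnP exprz_exp -!(expfzDr _ _ q0); congr (_ ^ _); ring.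
transitivity (2 * x * (B ^+ 2 / E) * (x ^+ 2 ^ r) * (q ^+ 3 * (q ^ (8%:Z * (r * r)) * q ^+ 8 ^ r))).
  by ring.
by rewrite h; ring.
Qed.

Lemma triple_sum_aN4 :
  has_sum (triple_term q (q ^ (- 4)) (fun j k => gauss_weight 1 (j%:Z - k%:Z)))
    ((2 * q^-1 * A ^+ 2 + 4 * B ^+ 2) / E * theta 8 (q ^+ 4)).
Proof.
have [s [h1 h2]] := gauss_triple_sum (expfz_neq0 (- 4) q0) (oner_neq0 _).
suff -> : (2 * q^-1 * A ^+ 2 + 4 * B ^+ 2) / E * theta 8 (q ^+ 4) = s by [].
have hG : has_sum (fun r : int => q ^ (8 * (r * r) + 4 * r)) (theta 8 (q ^+ 4)).
  apply: (eq_has_sum (@theta_sum 7 _ (expf_neq0 4 q0))) => r.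
  by rewrite exprnP exprz_exp -(expfzDr _ _ q0).
(* The factor 1 + q^(-4 d) and the parity of d produce four series; up to constants, reflection and
   translation carry all of them to [hG]. *)
have hGr := has_sum_reflect (-1) hG; have hGt := has_sum_translate 1 hG.
(* The translation makes the parity of the summation index that of the argument of
   [kappa (d - 1)]. *)
apply: has_sum_uniq (has_sum_translate 1 h2).
have -> : (2 * q^-1 * A ^+ 2 + 4 * B ^+ 2) / E * theta 8 (q ^+ 4) =
    (A ^+ 2 / E * q^-1) * (theta 8 (q ^+ 4) + theta 8 (q ^+ 4)) +
    (2 * B ^+ 2 / E) * (theta 8 (q ^+ 4) + theta 8 (q ^+ 4)) by ring.
apply: has_sum_parity.
  have H := has_sumZ (c := A ^+ 2 / E * q^-1) (has_sumD hGr hG).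
  apply: (eq_has_sum H) => r; rewrite diag_sum_aN4 addrK (kappa_even q1 q0).
  rewrite /gauss_weight exp1rz mulr1.
  set d := 2 * r + 1.
  have e1 : q ^ (d * d) * q ^ (d * d + 2 * d - 1)
      = q^-1 * q ^ (8 * ((-1 - r) * (-1 - r)) + 4 * (-1 - r)).
    by rewrite -exprN1 -!(expfzDr _ _ q0) /d; congr (_ ^ _); ring.
  have e2 : q ^ (d * d) * q ^ (- (4 * d)) * q ^ (d * d + 2 * d - 1)
      = q^-1 * q ^ (8 * (r * r) + 4 * r).
    by rewrite -exprN1 -!(expfzDr _ _ q0) /d; congr (_ ^ _); ring.
  transitivity (A ^+ 2 / E * (q^-1 * q ^ (8 * ((-1 - r) * (-1 - r)) + 4 * (-1 - r)) +
     q^-1 * q ^ (8 * (r * r) + 4 * r))); first by ring.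
  by rewrite -e1 -e2; ring.
have H := has_sumZ (c := 2 * B ^+ 2 / E) (has_sumD hGt hGr).
apply: (eq_has_sum H) => r; rewrite diag_sum_aN4 addrK (kappa_odd q1 q0).
rewrite /gauss_weight exp1rz mulr1.
set d := 2 * r + 1 + 1.
have e1 : q ^ (d * d) * q ^ (d * d + 2 * d - 1) * q
    = q ^ (8 * ((r + 1) * (r + 1)) + 4 * (r + 1)).
  by rewrite -[X in _ * X = _]expr1z -!(expfzDr _ _ q0) /d; congr (_ ^ _); ring.
have e2 : q ^ (d * d) * q ^ (- (4 * d)) * q ^ (d * d + 2 * d - 1) * q
    = q ^ (8 * ((-1 - r) * (-1 - r)) + 4 * (-1 - r)).
  by rewrite -[X in _ * X = _]expr1z -!(expfzDr _ _ q0) /d; congr (_ ^ _); ring.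
by rewrite -e1 -e2; ring.
Qed.

(** Apart from the weight, the summand is even in d. So the denominator 1 + q^(4 d) of [diag_sum_a4]
    cancels as soon as the symmetrised weight is divisible by it. *)
Lemma diag_sum_a4_sym (w : int -> C) (v : C) d :
  w d + w (- d) = v * (1 + q ^ (4 * d)) ->
  diag_sum q (q ^ 4) w d + diag_sum q (q ^ 4) w (- d)
  = v * (q ^ (d * d + 2 * d - 1) * kappa (d - 1)) / E.
Proof.
pose U (n : int) := q ^ (2 * (n * n)) * (shifted (n - 1) * shifted (- n - 1)).
have f (w' : int -> C) n : diag_sum q (q ^ 4) w' n = w' n * U n / E.
  by have := diag_sum_shifted w' 1 n; rewrite mulr1.
have UN : U (- d) = U d by rewrite /U mulrNN opprK (mulrC (shifted _)).
have := diag_sum_a4 (fun=> 1) d; rewrite !f mul1r UN => h e.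
rewrite -mulrDl -mulrDl e -(mulrA v) -(mulrA v) -(mulrA v).
by rewrite mulrA in h; rewrite h mul1r.
Qed.

Lemma addrr_inj (x y : C) : x + x = y + y -> x = y.
Proof.
have n2 : (2 : C) != 0 by rewrite pnatr_eq0.
have e2 (z : C) : z + z = 2 * z by ring.
by rewrite !e2; apply: mulfI.
Qed.

Lemma triple_sum_a4 :
  has_sum (triple_term q (q ^ 4) (fun j k => gauss_weight (q ^ (- 2)) (j%:Z - k%:Z)))
    (B ^+ 2 / E * theta 8 1 + 2^-1 * (q * (A ^+ 2 / E) * theta 8 (q ^+ 8))).
Proof.
have [s [h1 h2]] := gauss_triple_sum (expfz_neq0 4 q0) (expfz_neq0 (- 2) q0).
suff -> : B ^+ 2 / E * theta 8 1 + 2^-1 * (q * (A ^+ 2 / E) * theta 8 (q ^+ 8)) = s by [].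
(* Doubling by d -> - d works here because q^(-2 d) + q^(2 d) = q^(-2 d) (1 + q^(4 d)). *)
apply: addrr_inj; apply: has_sum_uniq (has_sumD h2 (has_sum_reflect 0 h2)).
set T := theta 8 (q ^+ 8); set T1 := theta 8 1.
have -> : B ^+ 2 / E * T1 + 2^-1 * (q * (A ^+ 2 / E) * T)
     + (B ^+ 2 / E * T1 + 2^-1 * (q * (A ^+ 2 / E) * T))
     = 2 * (B ^+ 2 / E) * T1 + q * (A ^+ 2 / E) * T.
  have n2 : (2 : C) != 0 by rewrite pnatr_eq0.
  transitivity (2 * (B ^+ 2 / E * T1) + 2 * 2^-1 * (q * (A ^+ 2 / E) * T)); first by ring.
  by rewrite divff // mul1r mulrA.
have sym d : diag_sum q (q ^ 4) (gauss_weight (q ^ (- 2))) d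
    + diag_sum q (q ^ 4) (gauss_weight (q ^ (- 2))) (0 - d)
    = q ^ (2 * (d * d) - 1) * kappa (d - 1) / E.
  rewrite sub0r (@diag_sum_a4_sym _ (q ^ (d * d - 2 * d))).
    have <- : q ^ (d * d - 2 * d) * q ^ (d * d + 2 * d - 1) = q ^ (2 * (d * d) - 1).
      by rewrite -(expfzDr _ _ q0); congr (_ ^ _); ring.
    by rewrite !mulrA.
  rewrite /gauss_weight mulrNN !exprz_exp mulrDr mulr1 -!(expfzDr _ _ q0).
  by congr (_ ^ _ + _ ^ _); ring.
apply: has_sum_parity.
  have H := has_sumZ (c := 2 * (B ^+ 2 / E)) (@theta_sum 7 _ (oner_neq0 C)).
  apply: (eq_has_sum H) => r; rewrite sym exp1rz mulr1.
  have -> : 2 * r - 1 = 2 * (r - 1) + 1 by ring.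
  rewrite (kappa_odd q1 q0).
  have <- : q ^ (2 * (2 * r * (2 * r)) - 1) * q = q ^ (8%:Z * (r * r)).
    by rewrite -[X in _ * X = _]expr1z -!(expfzDr _ _ q0); congr (_ ^ _); ring.
  by ring.
have H := has_sumZ (c := q * (A ^+ 2 / E)) (@theta_sum 7 _ (expf_neq0 8 q0)).
apply: (eq_has_sum H) => r; rewrite sym addrK (kappa_even q1 q0).
have -> : q ^ (2 * ((2 * r + 1) * (2 * r + 1)) - 1) = q * (q ^ (8%:Z * (r * r)) * q ^+ 8 ^ r).
  rewrite -[X in _ = X * _]expr1z exprnP exprz_exp -!(expfzDr _ _ q0).
  by congr (_ ^ _); ring.
by ring.
Qed.

End Evaluations.

(** * Theta series in q^3 *)

Section CubicTheta.
Context {R : realType}.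
Local Notation C := (R[i])%C.
Variable q : C.
Hypotheses (q1 : N q < 1) (q0 : q != 0).

Local Notation Q := (q ^+ 8).
Local Notation p := (q ^+ 4).
Local Notation A := (qpoch_inf (- q ^+ 4) Q).
Local Notation B := (qpoch_inf (- Q) Q).
Local Notation E := (qpoch_inf Q Q).
Local Notation kappa := (kappa q).
Local Notation shifted := (shifted q).
Local Notation gauss_weight := (gauss_weight q).
Let Q1 : N Q < 1. Proof. exact: NX_lt1. Qed.
Let p1 : N p < 1. Proof. exact: NX_lt1. Qed.

(** On an antidiagonal d = 2 j - n, so d^2 contains 4 j^2, the quadratic exponent of the q-binomial
    theorem in base q^8. *)
Lemma gauss_antidiagonal (x : C) (n : nat) : x != 0 ->
  \sum_(j < n.+1) gauss_weight x (j%:Z - (n - j)%N%:Z)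
     / (qpoch Q Q j * qpoch Q Q (n - j))
  = q ^ (n%:Z * n%:Z) * x ^ (- n%:Z)
    * (qpoch (- (q ^ (4 - 4 * n%:Z) * x ^+ 2)) Q n / qpoch Q Q n).
Proof.
move=> x0; rewrite -(qbinomial q1 q0) mulr_sumr; apply: eq_bigr => j _.
have jn : (j <= n)%N by rewrite -ltnS.
rewrite [RHS]mulrA; congr (_ / _).
rewrite /gauss_weight -subzn // exprMn.
have -> : x ^ (j%:Z - (n%:Z - j%:Z)) = x ^ (- n%:Z) * x ^+ 2 ^+ j.
  by rewrite -exprM exprnP -(expfzDr _ _ x0) PoszM; congr (_ ^ _); ring.
have -> : q ^ ((j%:Z - (n%:Z - j%:Z)) * (j%:Z - (n%:Z - j%:Z))) =
    q ^ (n%:Z * n%:Z) * (q ^ (4 * (j%:Z * j%:Z) - 4 * j%:Z) * (q ^ (4 - 4 * n%:Z)) ^+ j).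
  by rewrite exprnP exprz_exp -!(expfzDr _ _ q0); congr (_ ^ _); ring.
by ring.
Qed.

(** With d = 2 j - n one has 2 d^2 + 2 d = 2 n^2 - 2 n - 8 j (n - j) + 4 j, the exponent of
    [rogers_szego] up to a function of n. A coefficient [c] of period 2 is constant on
    antidiagonals. *)
Definition steep_weight (c : int -> C) (d : int) : C := c d * q ^ (2 * (d * d) + 2 * d).

Lemma steep_antidiagonal (c : int -> C) (n : nat) :
  (forall d m, c (d + 2 * m) = c d) ->
  \sum_(j < n.+1) steep_weight c (j%:Z - (n - j)%N%:Z)
     / (qpoch Q Q j * qpoch Q Q (n - j))
  = c n / qpoch p p n.
Proof.
move=> cper.
have -> : c n / qpoch p p n = c n * q ^ (2 * (n%:Z * n%:Z) - 2 * n%:Z)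
    * (q ^ (2 * (n%:Z * n%:Z) - 2 * n%:Z) * qpoch p p n)^-1.
  have Z := expfz_neq0 (2 * (n%:Z * n%:Z) - 2 * n%:Z) q0.
  by rewrite invfM (mulrA (c n * _)) mulfK.
rewrite -(rogers_szego q1 q0) mulr_sumr; apply: eq_bigr => j _.
have jn : (j <= n)%N by rewrite -ltnS.
rewrite [RHS]mulrA; congr (_ / _).
rewrite /steep_weight -subzn //.
have -> : j%:Z - (n%:Z - j%:Z) = n%:Z + 2 * (j%:Z - n%:Z) by ring.
rewrite cper -mulrA -(expfzDr _ _ q0); congr (_ * _ ^ _); ring.
Qed.

Lemma pair_term_antidiagonal (y : C) (w : nat -> nat -> C) n :
  \sum_(j < n.+1) pair_term q y w (j : nat, n - j)%N
  = q ^ (2 * (n%:Z * n%:Z)) * qpoch_inf (- (y * q ^ (4 - 4 * n%:Z))) Q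
    * \sum_(j < n.+1) w j (n - j)%N / (qpoch Q Q j * qpoch Q Q (n - j)).
Proof.
rewrite mulr_sumr; apply: eq_bigr => j _; rewrite /pair_term.
have jn : (j <= n)%N by rewrite -ltnS.
have -> : j%:Z + (n - j)%N%:Z = n by rewrite -PoszD subnKC.
by rewrite [RHS]mulrA.
Qed.

Lemma qpoch_shifted (n : nat) (m : int) :
  qpoch (- q ^ (4 - 4 * m)) Q n * shifted (m - 2 * n%:Z) = shifted m.
Proof.
have e : - q ^ (4 - 4 * m) * Q ^+ n = - q ^ (4 - 4 * (m - 2 * n%:Z)).
  rewrite mulNr -exprM exprnP -(expfzDr _ _ q0) PoszM.
  by congr (- _ ^ _); ring.
by have := qpoch_inf_split Q1 (- q ^ (4 - 4 * m)) n; rewrite e.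
Qed.

(** Since p^2 = Q, the tail of (-p; p)_oo after n factors splits into two products in base Q, both
    of the form [shifted]. *)
Lemma qpochN_shifted (n : nat) :
  qpoch (- p) p n * (shifted (- n%:Z) * shifted (- n%:Z - 1)) = A * B.
Proof.
have e1 : - p * p ^+ n = - q ^ (4 - 4 * (- n%:Z)).
  rewrite mulNr -exprS -exprM exprnP PoszM intS.
  by congr (- _ ^ _); ring.
have e2 : - q ^ (4 - 4 * (- n%:Z)) * p = - q ^ (4 - 4 * (- n%:Z - 1)).
  rewrite mulNr exprnP -(expfzDr _ _ q0).
  by congr (- _ ^ _); ring.
rewrite (qpoch_inf_AB q1) (qpoch_inf_split p1 (- p) n) e1.
by rewrite (qpoch_inf_split2 (- q ^ (4 - 4 * (- n%:Z))) p1) e2 -exprM.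
Qed.

Lemma qpochQ_split (n : nat) : qpoch Q Q n = qpoch p p n * qpoch (- p) p n.
Proof. by rewrite qpoch_sq -!exprM. Qed.

(** For x = q^r the linear exponent is (r + 2) j + (2 - r) k, which is 4 k for r = -2 and 2 j + 2 k
    for r = 0. *)
Definition mixed_weight (x : C) (j k : nat) : C :=
  gauss_weight x (j%:Z - k%:Z) * (q ^+ 2) ^+ (j + k).

Lemma mixed_triple_sum (y x : C) : x != 0 -> exists s,
  has_sum (triple_term q y (mixed_weight x)) s /\
  has_sum (pair_term q y (mixed_weight x)) s.
Proof.
move=> x0; have [L L1 LP] := exprz_growth x0.
have L0 : 0 <= L by apply: le_trans L1.
apply: (@triple_sum_rows _ _ q1 q0 y (mixed_weight x) 1 L L0) => j k.
rewrite mul1r -[leRHS]mulr1 /mixed_weight NM ler_pM ?N_ge0 //; last first.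
  by rewrite !NX !exprn_ile1 ?exprn_ge0 ?N_ge0 // ltW.
rewrite NM -[leRHS]mul1r ler_pM ?N_ge0 ?N_exprz_le1 // -?expr2 ?sqr_ge0 //.
by apply: le_trans (LP _) _; rewrite ler_weXn2l //; clear; lia.
Qed.

Lemma steep_triple_sum (y : C) (c : int -> C) (M : R) : y != 0 ->
  (forall d, N (c d) <= M) -> exists s,
  has_sum (pair_term q y (fun j k => steep_weight c (j%:Z - k%:Z))) s /\
  has_sum (diag_sum q y (steep_weight c)) s.
Proof.
move=> y0 cM; have [|s [_ h1 h2]] := @triple_sum _ _ q1 q0 y (steep_weight c) M 1 y0 (lexx _).
  move=> d; rewrite expr1n NM ler_pM ?N_ge0 // N_exprz_le1 //; clear; nia.
by exists s.
Qed.

Lemma mixed_antidiagonal (y x : C) (n : nat) : x != 0 ->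
  \sum_(j < n.+1) pair_term q y (mixed_weight x) (j : nat, n - j)%N
  = q ^ (3 * (n%:Z * n%:Z) + 2 * n%:Z) * x ^ (- n%:Z)
    * qpoch_inf (- (y * q ^ (4 - 4 * n%:Z))) Q
    * qpoch (- (q ^ (4 - 4 * n%:Z) * x ^+ 2)) Q n / (qpoch p p n * qpoch (- p) p n).
Proof.
move=> x0; rewrite pair_term_antidiagonal -qpochQ_split.
have -> : \sum_(j < n.+1) mixed_weight x j (n - j)%N / (qpoch Q Q j * qpoch Q Q (n - j))
   = (\sum_(j < n.+1) gauss_weight x (j%:Z - (n - j)%N%:Z)
     / (qpoch Q Q j * qpoch Q Q (n - j))) * (q ^+ 2) ^+ n.
  rewrite mulr_suml; apply: eq_bigr => j _; have jn : (j <= n)%N by rewrite -ltnS.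
  by rewrite /mixed_weight subnKC // mulrAC.
rewrite gauss_antidiagonal //.
have -> : q ^ (3 * (n%:Z * n%:Z) + 2 * n%:Z) =
    q ^ (2 * (n%:Z * n%:Z)) * q ^ (n%:Z * n%:Z) * (q ^+ 2) ^+ n.
  by rewrite -exprM exprnP PoszM -!(expfzDr _ _ q0); congr (_ ^ _); ring.
by ring.
Qed.

Lemma steep_pair_antidiagonal (y : C) (c : int -> C) (n : nat) :
  (forall d m, c (d + 2 * m) = c d) ->
  \sum_(j < n.+1) pair_term q y (fun j k => steep_weight c (j%:Z - k%:Z)) (j : nat, n - j)%N
  = q ^ (2 * (n%:Z * n%:Z)) * qpoch_inf (- (y * q ^ (4 - 4 * n%:Z))) Q * c n / qpoch p p n.
Proof.
by move=> cper; rewrite pair_term_antidiagonal steep_antidiagonal // [LHS]mulrA.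
Qed.

Lemma kappa_bounded : exists M : R, forall d, N (kappa d) <= M.
Proof.
exists (N (A ^+ 2) + N (2 * q * B ^+ 2)) => d.
have [r [->|->]] := int_parity d.
  by rewrite (kappa_even q1 q0) lerDl N_ge0.
by rewrite (kappa_odd q1 q0) lerDr N_ge0.
Qed.

Lemma AB_neq0 : A * B != 0.
Proof. by rewrite mulf_neq0 ?(A_neq0 q1) ?(B_neq0 q1). Qed.

Lemma mixed_steep_algebra1 (F : fieldType) (a a' b b' e e' v m P D X Y u1 u2 u3 k k' : F) :
  m * (a' * b') = D -> v * e' = b -> a * a' = u1 * k -> b * b' = u2 * k' ->
  e * e' = u3 * k' -> X * u1 * u2 = Y * u3 ->
  P != 0 -> D != 0 -> e' != 0 ->
  Y * e * (k / D) / P = X * a * v / (P * m).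
Proof.
move=> hm hv ha hb he hX P0 D0 e0.
have : m * (a' * b') != 0 by rewrite hm.
rewrite !mulf_eq0 !negb_or => /and3P[m0 a0 b0].
have h : X * a * v * D = Y * e * k * m.
  apply: (mulIf (mulf_neq0 (mulf_neq0 a0 b0) e0)).
  transitivity (X * (a * a') * (b' * (v * e')) * D); first by ring.
  rewrite hv (mulrC b') hb ha.
  transitivity (X * u1 * u2 * k * k' * D); first by ring.
  rewrite hX; transitivity (Y * k * (u3 * k') * D); first by ring.
  by rewrite -he -hm; ring.
transitivity (Y * e * k * m / (D * P * m)).
  by field; rewrite m0 P0 D0.
by rewrite -h; field; rewrite m0 P0 D0.
Qed.

Lemma mixed_steep_algebra2 (F : fieldType) (t a a' b b' v m P D X Y u k : F) :
  m * (a' * b') = D -> v * a' = a -> b * b' = u * k -> X * u = Y * t^-1 ->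
  P != 0 -> D != 0 -> t != 0 ->
  Y * a * (k / (t * D)) / P = X * b * v / (P * m).
Proof.
move=> hm hv hb hX P0 D0 t0.
have : m * (a' * b') != 0 by rewrite hm.
rewrite !mulf_eq0 !negb_or => /and3P[m0 a0 b0].
have h : X * b * v * D = Y * t^-1 * a * k * m.
  apply: (mulIf (mulf_neq0 a0 b0)).
  transitivity (X * (b * b') * (v * a') * D); first by ring.
  rewrite hv hb; transitivity (X * u * k * a * D); first by ring.
  by rewrite hX -hm; ring.
transitivity (Y * t^-1 * a * k * m / (D * P * m)).
  by field; rewrite t0 m0 P0 D0.
by rewrite -h; field; rewrite m0 P0 D0.
Qed.

Lemma theta3_sum (k : C) (z : C) (f : int -> C) s : z != 0 ->
  has_sum f s -> (forall d, f d = k * (q ^ (3%:Z * (d * d)) * z ^ d)) ->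
  s = k * theta q 3 z.
Proof.
move=> z0 fs fE; apply: has_sum_uniq fs _.
by apply: (eq_has_sum (has_sumZ (c := k) (@theta_sum _ _ q1 q0 2 _ z0))) => d; rewrite fE.
Qed.

(* After the sum over i, the terms with j + k = n are summed by the q-binomial
   theorem; the result is re-expanded by [rogers_szego] into a double sum to which
   [pair_sum_diag] applies. *)
Lemma triple_sum_c4 :
  has_sum (triple_term q 1 (mixed_weight (q ^ (- 2)))) (A * B / E * theta q 3 1).
Proof.
have x0 : q ^ (- 2) != 0 by rewrite expfz_neq0.
have [s [hs ps]] := mixed_triple_sum 1 x0.
have [M MP] := kappa_bounded.
(* Dictated by the comparison: written through [shifted], the antidiagonal sum of the mixed weight
   leaves [kappa n / (A * B)] and the product at n - 1, which is the one for y = q^4. *)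
pose c d := kappa d / (A * B).
have cper d m : c (d + 2 * m) = c d by rewrite /c (kappa_double q1 q0).
have [|s' [ps' ds']] := @steep_triple_sum (q ^ 4) c (M * N (A * B)^-1) (expfz_neq0 _ q0).
  by move=> d; rewrite NM ler_wpM2r ?N_ge0.
have es : s = s'.
  apply: has_sum_uniq (has_sum_antidiagonals ps) _.
  apply: (eq_has_sum (has_sum_antidiagonals ps')) => n.
  rewrite steep_pair_antidiagonal // mixed_antidiagonal // mul1r.
  have h1 := qpochN_shifted n; have h2 := qpoch_shifted n (n%:Z + 1).
  have h3 := shifted_mul q0 n%:Z; have h4 := shifted_mul q0 (n%:Z + 1).
  have h5 := shifted_mul q0 (n%:Z - 1).
  have e1 : - (q ^ (4 - 4 * n%:Z) * (q ^ (- 2)) ^+ 2) = - q ^ (4 - 4 * (n%:Z + 1)).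
    by rewrite exprnP exprz_exp -(expfzDr _ _ q0); congr (- _ ^ _); ring.
  have e2 : - (q ^ 4 * q ^ (4 - 4 * n%:Z)) = - q ^ (4 - 4 * (n%:Z - 1)).
    by rewrite -(expfzDr _ _ q0); congr (- _ ^ _); ring.
  have e3 : n%:Z + 1 - 2 * n%:Z = - (n%:Z - 1) by ring.
  have e4 : - (n%:Z + 1) = - n%:Z - 1 by ring.
  rewrite e1 e2; rewrite e3 in h2; rewrite e4 in h4.
  have P0 := qpochqq_neq0 p1 n; have AB0 := AB_neq0.
  have m0 : qpoch (- p) p n != 0.
    by apply: contraNneq AB0 => e; rewrite -h1 e mul0r.
  have s1 := shifted_neq0 q1 q0 (- n%:Z).
  have s2 := shifted_neq0 q1 q0 (- n%:Z - 1).
  have s3 := shifted_neq0 q1 q0 (- (n%:Z - 1)).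
  rewrite (kappaS q1 q0) in h4.
  have ex : q ^ (3 * (n%:Z * n%:Z) + 2 * n%:Z) * (q ^ (- 2)) ^ (- n%:Z)
      * q ^ (- (n%:Z * n%:Z)) * q ^ (- ((n%:Z + 1) * (n%:Z + 1)))
      = q ^ (2 * (n%:Z * n%:Z)) * q ^ (- ((n%:Z - 1) * (n%:Z - 1))).
    by rewrite exprz_exp -!(expfzDr _ _ q0); congr (_ ^ _); ring.
  exact: (mixed_steep_algebra1 h1 h2 h3 h4 h5 ex P0 AB0 s3).
suff -> : A * B / E * theta q 3 1 = s by [].
(* With y = q^4 the sum must again be symmetrised; the summand then contains
   [kappa (d - 1) * kappa d], a constant. *)
rewrite es; apply: addrr_inj.
have z1 : (1 : C) != 0 by exact: oner_neq0.
rewrite (@theta3_sum (2 * (A * B / E)) 1 _ _ z1 (has_sumD ds' (has_sum_reflect 0 ds'))).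
  by ring.
move=> d; rewrite exp1rz mulr1 sub0r.
rewrite (@diag_sum_a4_sym _ _ q1 q0 _ (c d * q ^ (2 * (d * d) - 2 * d))); last first.
  rewrite /steep_weight /c kappaN mulrNN mulrDr mulr1 -[X in _ = _ + X]mulrA -(expfzDr _ _ q0).
  by rewrite addrC; congr (_ * _ ^ _ + _ * _ ^ _); ring.
have hk := kappa_mul q1 q0 (d - 1); rewrite subrK in hk.
have AB0 := AB_neq0.
have e : q ^ (2 * (d * d) - 2 * d) * q ^ (d * d + 2 * d - 1) * q = q ^ (3%:Z * (d * d)).
  by rewrite -[X in _ * X = _]expr1z -!(expfzDr _ _ q0); congr (_ ^ _); ring.
transitivity (kappa (d - 1) * kappa d / (A * B) *
  (q ^ (2 * (d * d) - 2 * d) * q ^ (d * d + 2 * d - 1)) / E).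
  by rewrite /c; ring.
rewrite hk.
transitivity (2 * (A * B) * (A * B) / (A * B) / E *
  (q ^ (2 * (d * d) - 2 * d) * q ^ (d * d + 2 * d - 1) * q)); first by ring.
by rewrite e (mulfK AB0); ring.
Qed.

Lemma triple_sum_aN4_b2_c2 :
  has_sum (triple_term q (q ^ (- 4)) (mixed_weight 1)) (2 * (A * B / E) * theta q 3 (q ^+ 2)).
Proof.
have x0 : (1 : C) != 0 by exact: oner_neq0.
have [s [hs ps]] := mixed_triple_sum (q ^ (- 4)) x0.
have [M MP] := kappa_bounded.
pose c d := kappa (d + 1) / (q * (A * B)).
have cper d m : c (d + 2 * m) = c d by rewrite /c addrAC (kappa_double q1 q0).
have [|s' [ps' ds']] := @steep_triple_sum 1 c (M * N (q * (A * B))^-1) x0.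
  by move=> d; rewrite NM ler_wpM2r ?N_ge0.
have AB0 := AB_neq0.
have es : s = s'.
  apply: has_sum_uniq (has_sum_antidiagonals ps) _.
  apply: (eq_has_sum (has_sum_antidiagonals ps')) => n.
  rewrite steep_pair_antidiagonal // mixed_antidiagonal // mul1r.
  have h1 := qpochN_shifted n; have h2 := qpoch_shifted n n.
  have h4 := shifted_mul q0 (n%:Z + 1).
  have e1 : - (q ^ (4 - 4 * n%:Z) * 1 ^+ 2) = - q ^ (4 - 4 * n%:Z).
    by rewrite expr1n mulr1.
  have e2 : - (q ^ (- 4) * q ^ (4 - 4 * n%:Z)) = - q ^ (4 - 4 * (n%:Z + 1)).
    by rewrite -(expfzDr _ _ q0); congr (- _ ^ _); ring.
  have e3 : n%:Z - 2 * n%:Z = - n%:Z by ring.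
  have e4 : - (n%:Z + 1) = - n%:Z - 1 by ring.
  rewrite e1 e2 exp1rz mulr1; rewrite e3 in h2; rewrite e4 in h4.
  have P0 := qpochqq_neq0 p1 n.
  have ex : q ^ (3 * (n%:Z * n%:Z) + 2 * n%:Z) * q ^ (- ((n%:Z + 1) * (n%:Z + 1)))
      = q ^ (2 * (n%:Z * n%:Z)) * q^-1.
    by rewrite -exprN1 -!(expfzDr _ _ q0); congr (_ ^ _); ring.
  exact: (mixed_steep_algebra2 h1 h2 h4 ex P0 AB0 q0).
suff -> : 2 * (A * B / E) * theta q 3 (q ^+ 2) = s by [].
rewrite es -(@theta3_sum (2 * (A * B / E)) (q ^+ 2) _ _ (expf_neq0 2 q0) ds') //.
move=> d; rewrite (diag_sum_a0 q0) /steep_weight /c.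
have hk := kappa_mul q1 q0 d.
have e : q ^ (2 * (d * d) + 2 * d) * q ^ (d * d) = q ^ (3%:Z * (d * d)) * q ^+ 2 ^ d.
  by rewrite exprnP exprz_exp -!(expfzDr _ _ q0); congr (_ ^ _); ring.
rewrite -e invfM.
transitivity (kappa d * kappa (d + 1) * q^-1 / (A * B) *
  (q ^ (2 * (d * d) + 2 * d) * q ^ (d * d)) / E); first by ring.
rewrite hk.
transitivity (2 * (A * B) * (A * B) / (A * B) / E * (q / q) *
  (q ^ (2 * (d * d) + 2 * d) * q ^ (d * d))); first by ring.
by rewrite (mulfK AB0) divff // mulr1; ring.
Qed.

End CubicTheta.

(** * Powers of q and eta quotients *)

Section Bridge.
Context {R : realType}.
Local Notation C := (R[i])%C.
Variable tau : C.
Hypothesis htau : 0 < complex.Im tau.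

Lemma cexpD (x y : C) : cexp (x + y) = cexp x * cexp y.
Proof.
case: x => a b; case: y => c d; rewrite /cexp /= expRD cosD sinD.
rewrite rmorphM /= -!mulrA; congr (_ * _); rewrite mulrCA; congr (_ * _).
by apply/eqP; rewrite eq_complex /=; apply/andP; split; apply/eqP; ring.
Qed.

Lemma cexp0 : cexp (0 : C) = 1.
Proof. by rewrite /cexp /= expR0 cos0 sin0 mul1r. Qed.

Lemma N_cexp (z : C) : N (cexp z) = expR (complex.Re z).
Proof.
rewrite /cexp NM.
have -> : N (cos (complex.Im z) +i* sin (complex.Im z))%C = 1.
  by rewrite /N /= cos2Dsin2 sqrtr1.
by rewrite mulr1 /N /= expr0n addr0 sqrtr_sqr ger0_norm // expR_ge0.
Qed.

Lemma qpowD (r s : rat) : qpow tau (r + s) = qpow tau r * qpow tau s.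
Proof. by rewrite /qpow rmorphD /= -cexpD; congr cexp; ring. Qed.

Lemma qpow0 : qpow tau 0 = 1.
Proof. by rewrite /qpow rmorph0 mulr0 mul0r cexp0. Qed.

Lemma qpow_neq0 r : qpow tau r != 0.
Proof. by rewrite -N_gt0 N_cexp expR_gt0. Qed.

Lemma qpowN r : qpow tau (- r) = (qpow tau r)^-1.
Proof.
apply: (mulfI (qpow_neq0 r)); rewrite divff ?qpow_neq0 //.
by rewrite -qpowD subrr qpow0.
Qed.

Lemma qpowMn r n : qpow tau (r * n%:R) = qpow tau r ^+ n.
Proof.
elim: n => [|n IH]; first by rewrite mulr0 qpow0 expr0.
by rewrite -natr1 mulrDr mulr1 qpowD IH exprSr.
Qed.

Lemma qpowMz r (m : int) : qpow tau (r * m%:~R) = qpow tau r ^ m.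
Proof.
case: m => n; first by rewrite -pmulrn qpowMn.
by rewrite NegzE mulrNz mulrN qpowN -pmulrn qpowMn exprnN.
Qed.

Local Notation q := (qpow tau 1).

Lemma qpow_int (m : int) : qpow tau m%:~R = q ^ m.
Proof. by rewrite -[m%:~R]mul1r qpowMz. Qed.

Lemma qpow_nat (n : nat) : qpow tau n%:R = q ^+ n.
Proof. by rewrite -[n%:R]mul1r qpowMn. Qed.

Lemma N_q_lt1 : N q < 1.
Proof.
rewrite /qpow N_cexp -[X in _ < X]expR0 ltr_expR rmorph1 mulr1.
case: tau htau => a b /= b0.
have p0 := pi_gt0 R. have := mulr_gt0 p0 b0; nra.
Qed.

Lemma J_nat n : J tau n%:R = qpoch_inf (q ^+ n) (q ^+ n).
Proof. by rewrite /J qpow_nat. Qed.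

(** Only [x] carries a possibly fractional power, through [qpow tau r]; everything else is an
    integral power of q, as the analytic part requires. *)
Lemma term_gauss (a b c : rat) (y x : C) (t : nat * nat * nat) (za : int) (r : rat) :
  a = za%:~R -> b = r -> c = - r -> y = q ^ za -> x = qpow tau r ->
  triple_term q y (fun j k => gauss_weight q x (j%:Z - k%:Z)) t = term tau a b c t.
Proof.
move=> -> -> -> -> ->; case: t => [[i j] k]; rewrite /triple_term /term.
rewrite (qpow_nat 8); congr (_ / _).
have -> : (q ^ za) ^+ i = q ^ (za * i%:Z) by rewrite exprnP exprz_exp.
rewrite /gauss_weight -(qpowMz r) -!qpow_int -!qpowD; congr (qpow tau _).
by rewrite /quad; ring.
Qed.

Lemma term_mixed (a b c : rat) (y x : C) (t : nat * nat * nat) (za : int) (r : rat) :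
  a = za%:~R -> b = r + 2 -> c = 2 - r -> y = q ^ za -> x = qpow tau r ->
  triple_term q y (mixed_weight q x) t = term tau a b c t.
Proof.
move=> -> -> -> -> ->; case: t => [[i j] k]; rewrite /triple_term /term.
rewrite (qpow_nat 8); congr (_ / _).
have -> : (q ^ za) ^+ i = q ^ (za * i%:Z) by rewrite exprnP exprz_exp.
have -> : mixed_weight q (qpow tau r) j k = q ^ ((j%:Z - k%:Z) * (j%:Z - k%:Z))
    * qpow tau r ^ (j%:Z - k%:Z) * q ^ (2 * (j%:Z + k%:Z)).
  by rewrite /mixed_weight /gauss_weight -exprM exprnP PoszM PoszD.
rewrite -(qpowMz r) -!qpow_int -!qpowD; congr (qpow tau _).
by rewrite /quad; ring.
Qed.

End Bridge.

(** * Theta values as quotients of the products J_m *)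

Section EtaQuotients.
Context {R : realType}.
Local Notation C := (R[i])%C.
Variable q : C.
Hypotheses (q1 : N q < 1) (q0 : q != 0).

Definition eta (n : nat) : C := qpoch_inf (q ^+ n) (q ^+ n).

Lemma eta_neq0 n : eta n.+1 != 0.
Proof. by apply: qpochqq_inf_neq0; exact: NX_lt1. Qed.

Lemma qpoch_odd_eta n m l : m = (2 * n.+1)%N -> l = (4 * n.+1)%N ->
  qpoch_inf (- q ^+ n.+1) (q ^+ m) = eta m ^+ 2 / (eta n.+1 * eta l).
Proof.
move=> -> ->; have := qpoch_infN_odd (NX_lt1 n q1).
rewrite -!exprM ![(n.+1 * _)%N]mulnC -/(eta _) -/(eta _) -/(eta _) => <-.
by rewrite mulfK // mulf_neq0 ?eta_neq0.
Qed.

Lemma qpoch_self_eta n m : m = (2 * n.+1)%N ->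
  qpoch_inf (- q ^+ n.+1) (q ^+ n.+1) = eta m / eta n.+1.
Proof.
move=> ->; have := qpoch_infN_self (NX_lt1 n q1).
rewrite -!exprM ![(n.+1 * _)%N]mulnC -/(eta _) -/(eta _) => <-.
by rewrite mulrC mulKf // eta_neq0.
Qed.

Lemma qpoch_inf_split3 (z b : C) : N b < 1 ->
  qpoch_inf z b = qpoch_inf z (b ^+ 3) * qpoch_inf (z * b) (b ^+ 3)
    * qpoch_inf (z * b ^+ 2) (b ^+ 3).
Proof.
move=> b1; have b3 : N (b ^+ 3) < 1 by exact: NX_lt1.
have h := seq_cvgM (seq_cvgM (@qpoch_cvg _ _ b3 z) (@qpoch_cvg _ _ b3 (z * b)))
  (@qpoch_cvg _ _ b3 (z * b ^+ 2)).
apply: seq_cvg_uniq h.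
apply: (@eq_seq_cvg _ (fun n => qpoch z b (3 * n))).
  have /seq_cvgP c := @qpoch_cvg _ _ b1 z; apply/seq_cvgP => e /c[n0 n0P].
  by exists n0 => n nn0; apply: n0P; rewrite (leq_trans nn0) ?leq_pmull.
elim=> [|n IH]; first by rewrite muln0 !qpoch0 !mulr1.
by rewrite mulnS !addSn add0n !qpochS IH -!exprM !exprS; ring.
Qed.

Local Notation A := (qpoch_inf (- q ^+ 4) (q ^+ 8)).
Local Notation B := (qpoch_inf (- q ^+ 8) (q ^+ 8)).

Lemma A_eta : A = eta 8 ^+ 2 / (eta 4 * eta 16). Proof. exact: qpoch_odd_eta. Qed.
Lemma B_eta : B = eta 16 / eta 8. Proof. exact: qpoch_self_eta. Qed.

Lemma AB_eta : A * B / eta 8 = (eta 4)^-1.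
Proof. by rewrite /eta (qpoch_inf_E_AB q1) invfM mulrCA divff ?mulr1 // AB_neq0. Qed.

Lemma theta_phi n m l : m = (2 * n.+1)%N -> l = (4 * n.+1)%N ->
  theta q n.+1 1 = eta m ^+ 5 / (eta n.+1 ^+ 2 * eta l ^+ 2).
Proof.
move=> em el; rewrite /theta divr1 mulr1 -em (qpoch_odd_eta em el) -/(eta m).
have := eta_neq0 n; have : eta l != 0 by rewrite el; exact: eta_neq0.
by move: (eta _) (eta _) (eta _) => u v w h1 h2; field; rewrite h1 h2.
Qed.

Lemma theta8_psi : theta q 8 (q ^+ 8) = 2 * (eta 32 ^+ 2 / eta 16).
Proof.
rewrite /theta -exprD divff ?expf_neq0 // (qpoch_infN1 (NX_lt1 15 q1)).
rewrite (@qpoch_self_eta 15 32 erefl) -/(eta 16).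
have := eta_neq0 15; move: (eta 32) (eta 16) => u v h; field; exact: h.
Qed.

Lemma theta8_4 : theta q 8 (q ^+ 4) = A * eta 16.
Proof.
rewrite /theta -exprD (_ : q ^+ 8 / q ^+ 4 = q ^+ 4); last first.
  by rewrite -[8%N]/(4 + 4)%N exprD mulfK // expf_neq0.
rewrite -/(eta 16) [X in _ = X * _](qpoch_inf_split2 _ (NX_lt1 7 q1)).
by rewrite mulNr -exprD -exprM mulrC [in RHS]mulrC [X in _ * X]mulrC.
Qed.

Lemma trisect_solve (F : fieldType) (x1 x3 x5 u e3 e6 e12 : F) :
  e3 != 0 -> e6 != 0 -> e12 != 0 -> x3 = e6 ^+ 2 / (e3 * e12) ->
  u = x1 * x3 * x5 -> x5 * x1 * e6 = u * (e3 * e12 / e6).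
Proof. by move=> n3 n6 n12 -> ->; field; rewrite n3 n6 n12. Qed.

(** (-q; q^6)_oo (-q^5; q^6)_oo is (-q; q^2)_oo without its middle third (-q^3; q^6)_oo, and both of
    these are eta quotients. *)
Lemma theta3_2 : theta q 3 (q ^+ 2) = eta 2 ^+ 2 / (eta 1 * eta 4) * (eta 3 * eta 12 / eta 6).
Proof.
rewrite /theta -exprD (_ : q ^+ 3 / q ^+ 2 = q); last first.
  by rewrite exprS mulfK // expf_neq0.
rewrite -/(eta 6).
have h1 := @qpoch_odd_eta 0 2 4 erefl erefl; have h3 := @qpoch_odd_eta 2 6 12 erefl erefl.
have h := qpoch_inf_split3 (- q) (NX_lt1 1 q1).
rewrite -exprM mulNr -exprS mulNr -exprM -exprS in h.
rewrite expr1 in h1; rewrite h1 in h.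
exact: (trisect_solve (eta_neq0 2) (eta_neq0 5) (eta_neq0 11) h3 h).
Qed.

(** Ramanujan's phi(q) = phi(q^4) + 2 q psi(q^8): the sum of q^(d^2) split by the parity of d. *)
Lemma phi_split : A ^+ 2 * eta 8 + 2 * q * B ^+ 2 * eta 8 = eta 2 ^+ 5 / (eta 1 ^+ 2 * eta 4 ^+ 2).
Proof.
rewrite -(@theta_phi 0 2 4) //.
have tE : theta q 4 1 = A ^+ 2 * eta 8 by rewrite /theta divr1 mulr1 -expr2.
have tO : q * theta q 4 (q ^+ 4) = 2 * q * B ^+ 2 * eta 8.
  rewrite /theta divff ?expf_neq0 // -exprD (qpoch_infN1 (NX_lt1 7 q1)) -/(eta 8).
  by rewrite expr2; ring.
rewrite -tE -tO; apply: has_sum_uniq (theta_sum q1 q0 (oner_neq0 _)).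
apply: has_sum_parity.
  apply: (eq_has_sum (@theta_sum _ _ q1 q0 3 _ (oner_neq0 C))) => r.
  by rewrite !exp1rz !mulr1; congr (_ ^ _); ring.
apply: (eq_has_sum (has_sumZ (c := q) (@theta_sum _ _ q1 q0 3 _ (expf_neq0 4 q0)))) => r.
rewrite exp1rz mulr1 -[X in X * _]expr1z exprnP exprz_exp -!(expfzDr _ _ q0).
by congr (_ ^ _); ring.
Qed.

End EtaQuotients.

(** * Assembly of the five identities *)

Lemma qpochs_inf3 (K : numFieldType) (a b c q : K) :
  qpochs_inf [:: a; b; c] q = qpoch_inf a q * qpoch_inf b q * qpoch_inf c q.
Proof. by rewrite /qpochs_inf !big_cons big_nil mulr1 mulrA. Qed.

Lemma eta_algebra_nu (F : fieldType) (e4 e8 e16 t t' c x : F) :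
  e4 != 0 -> e8 != 0 -> e16 != 0 ->
  (e8 ^+ 2 / (e4 * e16)) ^+ 2 / e8 * t + 2 * c * x * ((e16 / e8) ^+ 2 / e8) * t'
  = e8 ^+ 3 * t / (e4 ^+ 2 * e16 ^+ 2) + 2 * (x * c) * (e16 ^+ 2 * t' / e8 ^+ 3).
Proof. by move=> n4 n8 n16; field; rewrite n4 n8 n16. Qed.

Lemma eta_algebra_a4 (F : fieldType) (e4 e8 e16 e32 c : F) :
  e4 != 0 -> e8 != 0 -> e16 != 0 -> e32 != 0 -> (2 : F) != 0 ->
  (e16 / e8) ^+ 2 / e8 * (e16 ^+ 5 / (e8 ^+ 2 * e32 ^+ 2))
    + 2^-1 * (c * ((e8 ^+ 2 / (e4 * e16)) ^+ 2 / e8) * (2 * (e32 ^+ 2 / e16)))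
  = e16 ^+ 7 / (e8 ^+ 5 * e32 ^+ 2) + c * (e8 ^+ 3 * e32 ^+ 2 / (e4 ^+ 2 * e16 ^+ 3)).
Proof. by move=> n4 n8 n16 n32 n2; field; rewrite n4 n8 n16 n32 n2. Qed.

(** The parity-even and parity-odd contributions share one theta factor, so their coefficients add
    up to a multiple of the left side of [phi_split] and collapse to a single quotient. *)
Lemma eta_algebra_aN4 (F : fieldType) (e1 e2 e4 e8 e16 a b c : F) :
  e1 != 0 -> e4 != 0 -> e8 != 0 -> e16 != 0 -> c != 0 ->
  a = e8 ^+ 2 / (e4 * e16) ->
  a ^+ 2 * e8 + 2 * c * b ^+ 2 * e8 = e2 ^+ 5 / (e1 ^+ 2 * e4 ^+ 2) ->
  (2 * c^-1 * a ^+ 2 + 4 * b ^+ 2) / e8 * (a * e16)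
  = 2 * c^-1 * (e2 ^+ 5 / (e1 ^+ 2 * e4 ^+ 3)).
Proof.
move=> n1 n4 n8 n16 c0 ha h.
transitivity (2 * c^-1 * (a ^+ 2 * e8 + 2 * c * b ^+ 2 * e8) * (a * e16 / e8 ^+ 2)).
  by field; rewrite n8 c0.
by rewrite h ha; field; rewrite n1 n4 n8 n16 c0.
Qed.

Lemma eta_algebra_c4 (F : fieldType) (e3 e4 e6 e12 : F) :
  e3 != 0 -> e4 != 0 -> e12 != 0 ->
  e6 ^+ 5 / (e3 ^+ 2 * e4 * e12 ^+ 2) = e4^-1 * (e6 ^+ 5 / (e3 ^+ 2 * e12 ^+ 2)).
Proof. by move=> n3 n4 n12; field; rewrite n3 n4 n12. Qed.

Lemma eta_algebra_aN4_b2_c2 (F : fieldType) (e1 e2 e3 e4 e6 e12 : F) :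
  e1 != 0 -> e4 != 0 -> e6 != 0 ->
  2 * (e2 ^+ 2 * e3 * e12 / (e1 * e4 ^+ 2 * e6))
  = 2 * e4^-1 * (e2 ^+ 2 / (e1 * e4) * (e3 * e12 / e6)).
Proof. by move=> n1 n4 n6; field; rewrite n1 n4 n6. Qed.

Section JacobiBar.
Context {R : realType}.
Variable tau : (R[i])%C.
Local Notation q := (qpow tau 1).

Lemma thetaV (m : nat) (z : (R[i])%C) : theta q m z^-1 = theta q m z.
Proof. by rewrite /theta invrK (mulrC (qpoch_inf (- (q ^+ m / z)) _)). Qed.

Lemma Jbar_theta (a : rat) (z : (R[i])%C) :
  qpow tau a = q ^+ 8 * z -> Jbar tau a 16 = theta q 8 z.
Proof.
move=> ha; have e16 : qpow tau 16 = q ^+ 16 by exact: (qpow_nat tau 16).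
have e2 : qpow tau (16 - a) = q ^+ 8 / z.
  rewrite qpowD qpowN e16 ha -[16%N]/(8 + 8)%N exprD invfM mulrA mulfK //.
  by rewrite expf_neq0 // qpow_neq0.
by rewrite /Jbar qpochs_inf3 e2 ha e16.
Qed.

End JacobiBar.

Theorem theorem3p1 (R : realType) (tau : R[i]) (htau : 0 < complex.Im tau) :
  (forall nu : rat,
     has_sum (term tau 0 (2 * nu) (- (2 * nu)))
       (J tau 8 ^+ 3 * Jbar tau (4 * (nu + 2)) 16
          / (J tau 4 ^+ 2 * J tau 16 ^+ 2)
        + 2 * qpow tau (2 * nu + 3)
          * (J tau 16 ^+ 2 * Jbar tau (- (4 * nu)) 16 / J tau 8 ^+ 3)))
  /\ has_sum (term tau 0 0 4)
       (J tau 6 ^+ 5 / (J tau 3 ^+ 2 * J tau 4 * J tau 12 ^+ 2))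
  /\ has_sum (term tau 4 (- 2) 2)
       (J tau 16 ^+ 7 / (J tau 8 ^+ 5 * J tau 32 ^+ 2)
        + qpow tau 1
          * (J tau 8 ^+ 3 * J tau 32 ^+ 2 / (J tau 4 ^+ 2 * J tau 16 ^+ 3)))
  /\ has_sum (term tau (- 4) 2 2)
       (2 * (J tau 2 ^+ 2 * J tau 3 * J tau 12
             / (J tau 1 * J tau 4 ^+ 2 * J tau 6)))
  /\ has_sum (term tau (- 4) 0 0)
       (2 * qpow tau (- 1) * (J tau 2 ^+ 5 / (J tau 1 ^+ 2 * J tau 4 ^+ 3))).
Proof.
set q := qpow tau 1.
have q1 : Normc.normc q < 1 by exact: N_q_lt1.
have q0 : q != 0 by exact: qpow_neq0.
have eN n : (0 < n)%N -> eta q n != 0 by case: n => // n _; exact: eta_neq0.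
have JE n : J tau n%:R = eta q n by rewrite J_nat.
have := (eN 1%N isT, eN 2%N isT, eN 3%N isT, eN 4%N isT, eN 6%N isT, eN 8%N isT, eN 12%N isT, eN 16%N isT, eN 32%N isT).
move=> [[[[[[[[n1 n2] n3] n4] n6] n8] n12] n16] n32].
have J1 : J tau 1 = eta q 1 by exact: (JE 1%N).
rewrite !JE J1.
split; [|split; [|split; [|split]]].
- move=> nu.
  have x0 := qpow_neq0 tau (2 * nu).
  have h := triple_sum_nu q1 q0 x0.
  have x2 : qpow tau (2 * nu) ^+ 2 = qpow tau (4 * nu).
    by rewrite -qpowMn; congr qpow; ring.
  have e8 : qpow tau 8 = q ^+ 8 by exact: (qpow_nat tau 8).
  have e3 : qpow tau 3 = q ^+ 3 by exact: (qpow_nat tau 3).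
  rewrite (@Jbar_theta _ tau (4 * (nu + 2)) (qpow tau (2 * nu) ^+ 2)); last first.
    by rewrite -e8 x2 -qpowD; congr qpow; ring.
  (* Here -4 nu = 8 - (8 + 4 nu), so the theta argument is the inverse of the one in
     [triple_sum_nu]; [thetaV] identifies the two. *)
  rewrite (@Jbar_theta _ tau (- (4 * nu)) (q ^+ 8 * qpow tau (2 * nu) ^+ 2)^-1); last first.
    by rewrite x2 invfM mulrA divff ?expf_neq0 // mul1r qpowN.
  rewrite thetaV qpowD e3.
  move: h; set t1 := theta _ _ _; set t2 := theta _ _ _; rewrite (A_eta q1) (B_eta q1).
  rewrite -/(eta q 8) (eta_algebra_nu _ _ _ _ n4 n8 n16) => h.
  apply: (eq_has_sum h) => t; apply: (@term_gauss _ tau _ _ _ _ _ _ 0 (2 * nu)) => //.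
- have h := triple_sum_c4 q1 q0; rewrite -/(eta q 8) (AB_eta q1) in h.
  rewrite (@theta_phi _ q q1 2 6 12 erefl erefl) in h.
  have -> : eta q 6 ^+ 5 / (eta q 3 ^+ 2 * eta q 4 * eta q 12 ^+ 2)
     = (eta q 4)^-1 * (eta q 6 ^+ 5 / (eta q 3 ^+ 2 * eta q 12 ^+ 2)).
    exact: (eta_algebra_c4 _ n3 n4 n12).
  apply: (eq_has_sum h) => t; apply: (@term_mixed _ tau _ _ _ _ _ _ 0 (- 2)) => //.
  exact: (esym (qpow_int tau (- 2))).
- have n2' : (2 : R[i]%C) != 0 by rewrite pnatr_eq0.
  have h := triple_sum_a4 q1 q0; rewrite -/(eta q 8) (A_eta q1) (B_eta q1) in h.
  rewrite (@theta_phi _ q q1 7 16 32 erefl erefl) (theta8_psi q1 q0) in h.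
  rewrite (eta_algebra_a4 _ n4 n8 n16 n32 n2') in h.
  apply: (eq_has_sum h) => t; apply: (@term_gauss _ tau _ _ _ _ _ _ 4 (- 2)) => //.
  exact: (esym (qpow_int tau (- 2))).
- have h := triple_sum_aN4_b2_c2 q1 q0; rewrite -/(eta q 8) (AB_eta q1) (theta3_2 q1 q0) in h.
  have -> : 2 * (eta q 2 ^+ 2 * eta q 3 * eta q 12 / (eta q 1 * eta q 4 ^+ 2 * eta q 6))
     = 2 * (eta q 4)^-1 * (eta q 2 ^+ 2 / (eta q 1 * eta q 4) * (eta q 3 * eta q 12 / eta q 6)).
    exact: (eta_algebra_aN4_b2_c2 _ _ _ n1 n4 n6).
  apply: (eq_has_sum h) => t; apply: (@term_mixed _ tau _ _ _ _ _ _ (- 4) 0) => //.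
  by rewrite qpow0.
- have h := triple_sum_aN4 q1 q0; rewrite -/(eta q 8) (theta8_4 q1 q0) in h.
  rewrite (eta_algebra_aN4 n1 n4 n8 n16 q0 (A_eta q1) (phi_split q1 q0)) in h.
  rewrite qpowN.
  apply: (eq_has_sum h) => t; apply: (@term_gauss _ tau _ _ _ _ _ _ (- 4) 0) => //.
  by rewrite qpow0.
Qed.
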